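(* Let $d\ge1$ and let $\mathcal X$ be a bootstrap percolation (BP) update family in $\mathbb Z^d$ contained in a half-space, i.e. such that there exists $u\in\mathbb R^d$ with $\langle x,u\rangle<0$ for all $X\in\mathcal X$ and all $x\in X$. Then $\mathcal X$ is either supercritical or subcritical; that is, exactly one of the following holds: (i) there exists a finite set $A\subset\mathbb Z^d$ such that $\bigcup_{t>0}\eta^A(t)$ is infinite; (ii) $q_{\mathrm c}>0$.
   Context: An update family is a finite family $\mathcal X$ of finite subsets of $\mathbb Z^d\setminus\{0\}$ (both the family and the sets in it may be empty). The BP with update family $\mathcal X$ is the discrete-time deterministic process on $\{0,1\}^{\mathbb Z^d}$ in which, at each time step, simultaneously for all sites, the state of a site $x\in\mathbb Z^d$ becomes $1$ if it is already $1$ or there exists $X\in\mathcal X$ such that all elements of $x+X$ are in state $1$; otherwise the state of $x$ is $0$. Configurations in $\{0,1\}^{\mathbb Z^d}$ are identified with the set of sites in state $1$; $\eta^A(t)$ is the configuration at time $t$ started from initial condition $A$. Let $\mu_q$ be the law of the process with i.i.d. Bernoulli($q$) initial condition and $$q_{\mathrm c}=\inf\left\{q\in[0,1]:\lim_{t\to\infty}\mu_q(\eta_0(t)\neq1)=0\right\}.$$ $\mathcal X$ is called supercritical if there exists a finite $A\subset\mathbb Z^d$ with $\bigcup_{t>0}\eta^A(t)$ infinite, and subcritical if $q_{\mathrm c}>0$. *)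

(* Defs.v *)
From HB Require Import structures.
From mathcomp Require Import all_boot all_order all_algebra.
From mathcomp Require Import finmap.
From mathcomp Require Import all_classical all_reals all_analysis measurable_realfun.
From mathcomp Require Import lra.

Set Implicit Arguments.
Unset Strict Implicit.
Unset Printing Implicit Defensive.

Import Order.TTheory GRing.Theory Num.Theory.
Import numFieldNormedType.Exports.

Local Open Scope classical_set_scope.
Local Open Scope ring_scope.

Definition coordinate_sets (I : Type) : set (set (I -> bool)) :=
  [set C | exists i, C = [set w : I -> bool | w i]].

(* {0, 1}^I with the product sigma-algebra. *)
Definition config (I : Type) := g_sigma_algebraType (@coordinate_sets I).

(* The family of coordinates is i.i.d. Bernoulli(q) under mu. *)
Definition is_bernoulli_product (R : realType) (I : choiceType) (q : R)
    (mu : set (config I) -> \bar R) : Prop :=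
  forall (S : {fset I}) (s : I -> bool),
    mu [set w | forall i, i \in S -> w i = s i] =
    (\prod_(i <- S) bernoulli_pmf q (s i))%:E.

(* Existence of the product measure: it is the image of the Lebesgue measure on
   [0, 1[ under the map sending x to the sequence of choices made when locating
   x by repeatedly cutting an interval of length l into a left part of length
   q * l (choice 1) and a right part of length (1 - q) * l (choice 0).  Here
   cut x n is the interval (left end, length) containing x after n cuts, and
   pcut s n is the interval reached by following the choices s. *)
Section construction.
Context {R : realType} (q : R) (q01 : 0 <= q <= 1).

Fixpoint cut (x : R) (n : nat) : R * R :=
  if n is m.+1 then
    let: (a, l) := cut x m in
    if x < a + q * l then (a, q * l) else (a + q * l, (1 - q) * l)
  else (0, 1).

Let bit x n := x < (cut x n).1 + q * (cut x n).2.

Let cutS x n : cut x n.+1 =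
  if bit x n then ((cut x n).1, q * (cut x n).2)
  else ((cut x n).1 + q * (cut x n).2, (1 - q) * (cut x n).2).
Proof. by rewrite /bit /=; case: (cut x n). Qed.

Fixpoint pcut (s : nat -> bool) (n : nat) : R * R :=
  if n is m.+1 then
    let: (a, l) := pcut s m in
    if s m then (a, q * l) else (a + q * l, (1 - q) * l)
  else (0, 1).

Let pcutS s n : pcut s n.+1 =
  if s n then ((pcut s n).1, q * (pcut s n).2)
  else ((pcut s n).1 + q * (pcut s n).2, (1 - q) * (pcut s n).2).
Proof. by rewrite /=; case: (pcut s n). Qed.

Let pcut2 s n : (pcut s n).2 = \prod_(i <- iota 0 n) bernoulli_pmf q (s i).
Proof.
elim: n => [|n IH]; first by rewrite big_nil.
rewrite pcutS -addn1 iotaD big_cat big_seq1 add0n -IH.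
by rewrite /bernoulli_pmf; case: (s n); rewrite /= mulrC.
Qed.

Let pcut2_ge0 s n : 0 <= (pcut s n).2.
Proof.
by rewrite pcut2; apply: prodr_ge0 => i _; exact: bernoulli_pmf_ge0.
Qed.

Let cut_pcut x s n : (forall i, (i < n)%N -> bit x i = s i) ->
  cut x n = pcut s n.
Proof.
elim: n => // n IH h; rewrite cutS pcutS h//.
by rewrite IH// => i ni; apply: h; exact: ltnW.
Qed.

Let cylE s n :
  `[0, 1[ `&` [set x | forall i, (i < n)%N -> bit x i = s i] =
  `[(pcut s n).1, (pcut s n).1 + (pcut s n).2[%classic.
Proof.
elim: n => [|n IH].
  rewrite /= add0r; apply/seteqP; split=> x /=; first by case.
  by move=> h; split.
have -> : [set x | forall i, (i < n.+1)%N -> bit x i = s i] =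
    [set x | forall i, (i < n)%N -> bit x i = s i] `&`
    [set x | bit x n = s n].
  apply/seteqP; split=> x /= => [h|[h1 h2] i].
    by split=> [i ni|]; apply: h => //; exact: ltnW.
  by rewrite ltnS leq_eqVlt => /orP[/eqP->//|]; exact: h1.
have l0 := pcut2_ge0 s n.
apply/seteqP; split=> x.
- move=> [x01 [h1 h2]]; rewrite pcutS.
  have : `[(pcut s n).1, (pcut s n).1 + (pcut s n).2[%classic x by rewrite -IH.
  rewrite /= in_itv /= => /andP[xl xr].
  move: h2; rewrite /= /bit (cut_pcut h1).
  case: (s n); rewrite /= in_itv /=; first by move=> ->; rewrite xl.
  by move/negbT; rewrite -leNgt => -> /=; nra.
- rewrite pcutS => xI.
  have : `[(pcut s n).1, (pcut s n).1 + (pcut s n).2[%classic x.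
    rewrite /= in_itv /=; move: xI q01 => /[swap] /andP[q0 q1].
    by case: (s n); rewrite /= in_itv /= => /andP[? ?]; apply/andP; split; nra.
  rewrite -IH => -[x01 h1]; split => //; split => //.
  move: xI; rewrite /= /bit (cut_pcut h1).
  case: (s n); rewrite /= in_itv /= => /andP[]; first by [].
  by rewrite leNgt => /negbTE.
Qed.

Let measurable_cut n :
  measurable_fun setT (fun x => (cut x n).1) /\
  measurable_fun setT (fun x => (cut x n).2).
Proof.
elim: n => [|n [m1 m2]]; first by split; exact: measurable_cst.
have mq c : measurable_fun setT (fun x => c * (cut x n).2).
  by apply: measurable_funM.
have mb : measurable_fun setT (fun x => bit x n).
  by apply: measurable_fun_ltr => //; exact: measurable_funD.
split.
- rewrite (_ : (fun x => _) = fun x => if bit x n then (cut x n).1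
      else (cut x n).1 + q * (cut x n).2); last first.
    by apply/funext => x; rewrite cutS; case: ifP.
  by apply: measurable_fun_ifT => //; exact: measurable_funD.
- rewrite (_ : (fun x => _) = fun x => if bit x n then q * (cut x n).2
      else (1 - q) * (cut x n).2); last first.
    by apply/funext => x; rewrite cutS; case: ifP.
  exact: measurable_fun_ifT.
Qed.

Let measurable_bit n : measurable [set x | bit x n].
Proof.
have [m1 m2] := measurable_cut n.
have mb : measurable_fun setT (fun x => bit x n).
  apply: measurable_fun_ltr => //; apply: measurable_funD => //.
  exact: measurable_funM.
rewrite (_ : [set x | _] = setT `&` (fun x => bit x n) @^-1` [set true]).
  exact: mb.
by apply/seteqP; split=> x /=; [move=> ->|case].
Qed.

Let measurable_bitb n b : measurable [set x | bit x n = b].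
Proof.
case: b; first exact: measurable_bit.
rewrite (_ : [set x | _] = ~` [set x | bit x n]).
  by apply: measurableC; exact: measurable_bit.
by apply/seteqP; split=> x /= => [->|/negP/negbTE].
Qed.

Let cyl (T : seq nat) s : set R :=
  `[0, 1[ `&` [set x | forall i, i \in T -> bit x i = s i].

Let measurable_cyl T s : measurable (cyl T s).
Proof.
apply: measurableI => //; elim: T => [|j T IH].
  by rewrite (_ : [set x | _] = setT)//; apply/seteqP; split.
rewrite (_ : [set x | _] = [set x | bit x j = s j] `&`
    [set x | forall i, i \in T -> bit x i = s i]).
  exact: measurableI.
apply/seteqP; split=> x /= => [h|[h1 h2] i].
  by split=> [|i iT]; apply: h; rewrite inE ?eqxx ?iT ?orbT.
by rewrite inE => /orP[/eqP->//|]; exact: h2.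
Qed.

Let weight T := forall s, lebesgue_measure (cyl T s) =
  (\prod_(i <- T) bernoulli_pmf q (s i))%:E.

Let weight_iota n : weight (iota 0 n).
Proof.
move=> s; rewrite -pcut2.
have -> : cyl (iota 0 n) s =
    `[0, 1[ `&` [set x | forall i, (i < n)%N -> bit x i = s i].
  congr setI; apply/seteqP; split=> x /= h i; first last.
    by rewrite mem_iota; exact: h.
  by move=> ni; apply: h; rewrite mem_iota.
rewrite cylE lebesgue_measure_itv /= lte_fin ltrDl.
have := pcut2_ge0 s n; rewrite le_eqVlt => /orP[/eqP<-|->].
  by rewrite ltxx.
by rewrite -EFinD addrAC subrr add0r.
Qed.

Let weight_tail j T : uniq (j :: T) -> weight (j :: T) -> weight T.
Proof.
move=> /= /andP[jT uT] w s.
pose sb b i := if i == j then b else s i.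
have sbT b : {in T, sb b =1 s}.
  by move=> i iT; rewrite /sb; case: eqP jT => // <-; rewrite iT.
have -> : cyl T s = cyl (j :: T) (sb true) `|` cyl (j :: T) (sb false).
  apply/seteqP; split=> x.
  - move=> [x01 h].
    have hb : cyl (j :: T) (sb (bit x j)) x.
      split=> // i; rewrite inE => /predU1P[->|iT]; first by rewrite /sb eqxx.
      by rewrite sbT//; exact: h.
    by case: (bit x j) hb => ?; [left|right].
  - by case=> -[x01 h]; split=> // i iT; rewrite h ?inE ?iT ?orbT// sbT.
transitivity (lebesgue_measure (cyl (j :: T) (sb true)) +
    lebesgue_measure (cyl (j :: T) (sb false)))%E.
  apply: measureU; [exact: measurable_cyl|exact: measurable_cyl|].
  rewrite -subset0 => x [[_ h1] [_ h2]].
  have := h1 j; have := h2 j; rewrite inE eqxx /sb eqxx /= => -> //.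
  by move=> /(_ isT).
rewrite !w -EFinD; congr EFin.
have prodE b : \prod_(i <- j :: T) bernoulli_pmf q (sb b i) =
    bernoulli_pmf q b * \prod_(i <- T) bernoulli_pmf q (s i).
  rewrite big_cons {1}/sb eqxx; congr (_ * _).
  by apply: eq_big_seq => i /sbT ->.
by rewrite !prodE /bernoulli_pmf -mulrDl addrC subrK mul1r.
Qed.

Let weight_catr T1 T2 : uniq (T1 ++ T2) -> weight (T1 ++ T2) -> weight T2.
Proof.
elim: T1 => [//|j T1 IH] u w; apply: IH; first by case/andP: u.
exact: weight_tail u w.
Qed.

Let weight_uniq T : uniq T -> weight T.
Proof.
move=> uT; pose N := (\max_(i <- T) i).+1.
pose T' := [seq i <- iota 0 N | i \notin T].
have uT' : uniq (T' ++ T).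
  rewrite cat_uniq filter_uniq ?iota_uniq//= uT andbT.
  by apply/hasPn => i iT; rewrite mem_filter iT.
have p : perm_eq (T' ++ T) (iota 0 N).
  apply: uniq_perm; rewrite ?iota_uniq// => i.
  rewrite mem_cat mem_filter mem_iota leq0n add0n /=.
  case: (boolP (i \in T)) => //= iT; last by rewrite orbF.
  by rewrite ltnS; apply/esym; exact: (@leq_bigmax_seq _ _ xpredT id).
apply: (weight_catr uT') => s; rewrite (perm_big _ p) -weight_iota.
congr lebesgue_measure; congr setI.
apply/seteqP; split=> x /= h i; first by rewrite -(perm_mem p); exact: h.
by rewrite (perm_mem p); exact: h.
Qed.

Lemma bernoulli_product_exists01 (I : countType) :
  exists mu : probability (config I) R, is_bernoulli_product q mu.
Proof.
pose f (x : R) : config I := fun i => bit x (choice.pickle i).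
have mf : measurable_fun setT f.
  apply: (measurability (@coordinate_sets I : set (set (config I)))) => //.
  move=> _ [_ [i ->] <-]; rewrite setTI; exact: measurable_bit.
have mD : measurable (`[0, 1[%classic : set R) by [].
pose nu := pushforward (mrestr lebesgue_measure mD) f.
have nuP : exists m : {measure set (config I) -> \bar R}, m = nu :> (set _ -> _).
  by unshelve (exists (pushforward (mrestr lebesgue_measure mD) f)).
case: nuP => m mE.
have m1 : m setT = 1%E.
  rewrite mE /nu /pushforward /mrestr preimage_setT setTI.
  by rewrite lebesgue_measure_itv /= lte_fin ltr01 oppr0 adde0.
have muE U : mnormalize m point U = m U.
  by rewrite /mnormalize m1 onee_eq0 /= invr1 mule1.
exists (mnormalize m point) => S s.
apply: etrans; [exact: muE|rewrite mE /nu /pushforward /mrestr].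
have uS : uniq [seq choice.pickle i | i <- S].
  by rewrite map_inj_uniq ?fset_uniq//; exact: pcan_inj choice.pickleK.
pose s' n := if choice.unpickle n is Some i then s i else false.
transitivity (lebesgue_measure (cyl [seq choice.pickle i | i <- S] s')).
  apply: (congr1 lebesgue_measure).
  rewrite setIC; congr setI; apply/seteqP; split=> x /= h => [n|i iS].
    by move=> /mapP[i iS ->]; rewrite /s' choice.pickleK; exact: h.
  by rewrite /f h ?map_f// /s' choice.pickleK.
rewrite weight_uniq// big_map; congr EFin.
by apply: eq_bigr => i _; rewrite /s' choice.pickleK.
Qed.

End construction.

Lemma bernoulli_product_exists (R : realType) (I : countType) (q : R) :
  exists mu : probability (config I) R,
    0 <= q <= 1 -> is_bernoulli_product q mu.
Proof.
have [q01|_] := boolP (0 <= q <= 1).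
  by have [mu muP] := bernoulli_product_exists01 q01 I; exists mu.
have z01 : (0 : R) <= (0 : R) <= 1 by rewrite lexx ler01.
by have [mu _] := bernoulli_product_exists01 z01 I; exists mu.
Qed.

(* Unspecified when q is outside [0, 1]. *)
Definition bernoulli_product (R : realType) (I : countType) (q : R) :
  probability (config I) R := projT1 (cid (bernoulli_product_exists I q)).

Lemma bernoulli_productP (R : realType) (I : countType) (q : R) :
  0 <= q <= 1 -> is_bernoulli_product q (bernoulli_product I q).
Proof. exact: projT2 (cid (bernoulli_product_exists I q)). Qed.

Section bootstrap_percolation.
Context {d : nat}.

Notation site := 'rV[int]_d.

Definition is_update_family (X : {fset {fset site}}) : Prop :=
  forall U, U \in X -> 0 \notin U.

Definition bp_step (X : {fset {fset site}}) (w : config site) : config site :=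
  fun x => w x || has (fun U : {fset site} => all (fun y => w (x + y)) U) X.

(* The configuration at time t, started from w. *)
Definition bp (X : {fset {fset site}}) (w : config site) (t : nat) :
  config site := iter t (bp_step X) w.

Definition inner (R : realType) (x : site) (u : 'rV[R]_d) : R :=
  \sum_(i < d) (x 0 i)%:~R * u 0 i.

Definition in_half_space (R : realType) (X : {fset {fset site}}) : Prop :=
  exists u : 'rV[R]_d, forall U x, U \in X -> x \in U -> inner x u < 0.

Definition supercritical (X : {fset {fset site}}) : Prop :=
  exists A : {fset site}, infinite_set
    (\bigcup_(t in [set t | (0 < t)%N]) [set x | bp X (fun y => y \in A) t x]).

Definition q_c (R : realType) (X : {fset {fset site}}) : R :=
  inf [set q : R | 0 <= q <= 1 /\
    bernoulli_product site q [set w | bp X w t 0 != true] @[t --> \oo]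
      --> 0%E].

Definition subcritical (R : realType) (X : {fset {fset site}}) : Prop :=
  0 < q_c R X.

End bootstrap_percolation.

(* Main.v *)
(* Let a selection be a choice f of one point f U in each U in X. By Gordan's
   alternative, either (a) some nonzero v lies in the cone spanned by the f U
   for every selection f, or (b) there are vectors u_f summing to 0 such that
   <f U, u_f> is bounded below by s > 0 for all f and U.

   In case (a) a finite set of sites infects the whole tube of points
   sum_z a_z z - t v with 0 <= a_z <= 1 and t >= 0, z ranging over the points of
   the update rules. Hence X is supercritical, and at every density q > 0 the
   origin lies in the tube of some fully infected translate of the finite set.

   In case (b), which is Toom's eroder condition, a set of the form
   {x | <x, u_f> <= phi_f x for all f} with slowly varying phi_f is stable under
   the dynamics. A sparse set A is decomposed into clusters of diameter b_k
   isolated at scale H_k >> b_k. Adding the clusters scale by scale, starting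
   from the largest, gives a stable set that is locally of this form, contains
   A and stays close to the clusters. A cluster of scale k at a given place
   requires one of N_k configurations of 2^k points of A with
   log N_k = O(2^k), so at low density the origin stays healthy with
   probability at least 1/2. *)
From HB Require Import structures.
Require Import Defs.
From mathcomp Require Import all_boot all_order all_algebra.
From mathcomp Require Import finmap zify ring lra.
From mathcomp Require Import all_classical all_reals all_analysis.

Set Implicit Arguments.
Unset Strict Implicit.
Unset Printing Implicit Defensive.

Import Order.TTheory GRing.Theory Num.Theory.
Import numFieldNormedType.Exports.

Local Open Scope classical_set_scope.
Local Open Scope ring_scope.

(** * Theorems of the alternative *)

Section farkas.
Context {R : realFieldType} {W : lmodType R} (Z : W -> Prop).
Hypothesis Z0 : Z 0.
Hypothesis ZD : forall c x y, Z x -> Z y -> Z (x + c *: y).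

(* Bartl's induction on the number of functionals. *)
Lemma farkas n (a : 'I_n -> {linear W -> R^o}) (b : {linear W -> R^o}) :
  (exists2 l : 'I_n -> R, forall k, 0 <= l k &
     forall x, Z x -> b x = \sum_k l k * a k x) \/
  (exists x, [/\ Z x, forall k, 0 <= a k x & b x < 0]).
Proof.
elim: n a b => [|n IH] a b.
  have [[x [Zx bx]]|nx] := pselect (exists x, Z x /\ b x != 0); last first.
    left; exists (fun=> 0) => // x Zx; rewrite big_ord0.
    by apply: contrapT => /eqP bx; apply: nx; exists x.
  right; exists (0 + (- b x) *: x); split; [exact: ZD|by case|].
  rewrite linearD linear0 linearZ add0r /= /GRing.scale /= mulNr oppr_lt0.
  by rewrite -expr2 exprn_even_gt0.
pose c := a ord_max; pose a' k := a (widen_ord (leqnSn n) k).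
have aS (P : {linear W -> R^o} -> Prop) :
    (forall k, P (a' k)) -> P c -> forall k, P (a k).
  move=> Pa Pc k; case: (unliftP ord_max k) => [j ->|->//].
  have -> : lift ord_max j = widen_ord (leqnSn n) j.
    by apply/val_inj; exact: lift_max.
  exact: Pa.
have [[l l0 bE]|[x [Zx ax bx]]] := IH a' b.
  left; exists (fun k => if unlift ord_max k is Some j then l j else 0).
    by move=> k; case: unlift.
  move=> x Zx; rewrite big_ord_recr /= unlift_none mul0r addr0 bE//.
  apply: eq_bigr => k _; rewrite -/(a' k).
  have -> : widen_ord (leqnSn n) k = lift ord_max k.
    by apply/val_inj; rewrite /= /bump leqNgt ltn_ord.
  by rewrite liftK.
have [cx|cx] := leP 0 (c x).
  by right; exists x; split => // k; apply: (aS (fun f => 0 <= f x)).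
(* Elimination of [c]: as [e * c x = -1], replacing each [f] by [f + e * f x * c] makes it vanish at
   [x], and one functional fewer is left. *)
pose e := - (c x)^-1.
have e0 : 0 < e by rewrite oppr_gt0 invr_lt0.
have ecx : e * c x = -1 by rewrite mulNr mulVf// lt_eqF.
have mk (f : {linear W -> R^o}) :
    exists g : {linear W -> R^o}, forall y, g y = f y + e * f x * c y.
  have lin : linear (fun y => f y + e * f x * c y : R^o).
    move=> k y y'; rewrite !linearP /= /GRing.scale /=; ring.
  pose hg := GRing.isLinear.Build _ _ _ _ _ lin.
  pose g : {linear W -> R^o} := HB.pack (fun y => f y + e * f x * c y : R^o) hg.
  by exists g.
have [a2 a2E] : exists a2 : 'I_n -> {linear W -> R^o},
    forall k y, a2 k y = a' k y + e * a' k x * c y.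
  by have [g gE] := choice (fun k => mk (a' k)); exists g.
have [b2 b2E] := mk b.
have [[l l0 bE]|[x' [Zx' ax' bx']]] := IH a2 b2.
  (* [lc] is the coefficient of [c] left over when [b2] and [a2] are expanded; it is nonnegative
     because [b x < 0 <= a' k x]. *)
  left; pose lc := e * (\sum_k l k * a' k x - b x).
  exists (fun k => if unlift ord_max k is Some j then l j else lc).
    move=> k; case: unlift => //; rewrite mulr_ge0 ?(ltW e0)// subr_ge0.
    apply: le_trans (ltW bx) _; apply: sumr_ge0 => j _.
    by rewrite mulr_ge0.
  move=> y Zy; rewrite big_ord_recr /= unlift_none.
  rewrite (eq_bigr (fun k => l k * a' k y)); last first.
    move=> k _; have -> : widen_ord (leqnSn n) k = lift ord_max k.
      by apply/val_inj; rewrite /= /bump leqNgt ltn_ord.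
    rewrite liftK; congr (_ * (a _ _)).
    by apply/val_inj; rewrite /= /bump leqNgt ltn_ord.
  have h := bE y Zy; rewrite b2E in h.
  rewrite (eq_bigr (fun k => l k * a' k y + l k * (e * a' k x * c y))) in h;
    last by move=> k _; rewrite a2E mulrDr.
  rewrite big_split /= in h.
  have hs : \sum_k l k * (e * a' k x * c y) = e * (\sum_k l k * a' k x) * c y.
    by rewrite mulr_sumr mulr_suml; apply: eq_bigr => k _; ring.
  rewrite hs in h; rewrite -/c /lc.
  by move: h; move: (\sum_k _) => A; move: (\sum_k _) => B; lra.
(* At this point [c] vanishes, and any other [f] takes the value of its eliminated version at
   [x']. *)
right; exists (x' + (e * c x') *: x).
have hE (f : {linear W -> R^o}) :
    f (x' + (e * c x') *: x) = f x' + e * f x * c x'.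
  by rewrite linearD linearZ /= /GRing.scale /=; ring.
split; first exact: ZD.
- apply: (aS (fun f => 0 <= f _)) => [k|].
    by rewrite hE -a2E.
  by rewrite hE ecx mulN1r subrr.
- by rewrite hE -b2E.
Qed.

End farkas.

(** [farkas] is applied to pairs (x, s) with constraints [a k x - s >= 0] and target [- s]. In the
    dual case, evaluation at (0, 1) shows that the multipliers sum to 1, so one is positive. *)
Lemma gordan (R : realFieldType) (W : lmodType R) (Z : W -> Prop) (K : finType)
    (a : K -> {linear W -> R^o}) :
  Z 0 -> (forall c x y, Z x -> Z y -> Z (x + c *: y)) ->
  (exists x, Z x /\ exists2 s, 0 < s & forall k, s <= a k x) \/
  (exists l : K -> R, [/\ forall k, 0 <= l k, exists k, 0 < l k &
     forall x, Z x -> \sum_k l k * a k x = 0]).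
Proof.
move=> Z0 ZD.
pose W2 : lmodType R := (W * R^o)%type.
pose Z2 (x : W2) := Z x.1.
have [A AE] : exists A : K -> {linear W2 -> R^o},
    forall k x, A k x = a k x.1 - x.2.
  have mk k : exists g : {linear W2 -> R^o}, forall x, g x = a k x.1 - x.2.
    have lin : linear (fun x : W2 => a k x.1 - x.2 : R^o).
      by move=> c x y /=; rewrite linearP /= /GRing.scale /=; ring.
    pose hg := GRing.isLinear.Build _ _ _ _ _ lin.
    pose g : {linear W2 -> R^o} :=
      HB.pack (fun x : W2 => a k x.1 - x.2 : R^o) hg.
    by exists g.
  by have [g gE] := choice mk; exists g.
have [B BE] : exists g : {linear W2 -> R^o}, forall x, g x = - x.2.
  have lin : linear (fun x : W2 => - x.2 : R^o).
    by move=> c x y /=; rewrite opprD scalerN.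
  pose hg := GRing.isLinear.Build _ _ _ _ _ lin.
  pose g : {linear W2 -> R^o} := HB.pack (fun x : W2 => - x.2 : R^o) hg.
  by exists g.
have [||[l l0 bE]|[[x s] [Zx ax bx]]] :=
    @farkas R W2 Z2 _ _ #|K| (fun i => A (enum_val i)) B.
- exact: Z0.
- by move=> c x y; exact: ZD.
- right; pose L k := l (enum_rank k).
  have sumE (x : W2) : Z x.1 -> - x.2 = \sum_k L k * (a k x.1 - x.2).
    move=> Zx; apply: etrans (esym (BE x)) (etrans (bE x Zx) _).
    rewrite [RHS](reindex _ (onW_bij _ (enum_val_bij K))).
    by apply: eq_bigr => i _; rewrite AE /L enum_valK.
  have s1 : \sum_k L k = 1.
    apply: oppr_inj; rewrite (sumE (0, 1) Z0) -sumrN.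
    by apply: eq_bigr => k _; rewrite /= linear0 sub0r mulrN1.
  exists L; split => [k|//|x Zx]; first exact: l0.
    apply: contrapT => h; have : \sum_k L k = 0.
      apply: big1 => k _; apply/eqP; rewrite eq_le l0 andbT leNgt.
      by apply/negP => k0; apply: h; exists k.
    by rewrite s1 => /eqP; rewrite oner_eq0.
  apply: etrans (etrans _ (esym (sumE (x, 0) Zx))) (oppr0 _).
  by apply: eq_bigr => k _; rewrite subr0.
- left; exists x; split=> //; exists s.
    by move: bx; rewrite BE oppr_lt0.
  by move=> k; have := ax (enum_rank k); rewrite AE enum_rankK subr_ge0.
Qed.

(** * The l1 metric on the lattice *)

Section l1_norm.
Context {d : nat}.
Implicit Types x y : 'rV[int]_d.

Definition l1 x : nat := (\sum_i absz (x 0%R i))%N.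

Lemma l1_0 : l1 0 = 0%N.
Proof. by apply: big1 => i _; rewrite mxE. Qed.

Lemma l1N x : l1 (- x) = l1 x.
Proof. by apply: eq_bigr => i _; rewrite mxE abszN. Qed.

Lemma l1D x y : (l1 (x + y) <= l1 x + l1 y)%N.
Proof.
rewrite /l1 -big_split /=; apply: leq_sum => i _; rewrite mxE.
by move: (x _ _) (y _ _) => a b; lia.
Qed.

Definition l1d x y := l1 (x - y).

Lemma l1dC x y : l1d x y = l1d y x.
Proof. by rewrite /l1d -l1N opprB. Qed.

Lemma l1d_tri z x y : (l1d x y <= l1d x z + l1d z y)%N.
Proof. by rewrite /l1d -(subrKA z x); exact: l1D. Qed.

(** A cube that contains the l1 ball of radius [n]; its cardinality is a plain power. *)
Definition ball_seq (n : nat) : seq 'rV[int]_d :=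
  [seq \row_i ((f i)%:Z - n%:Z) | f : {ffun 'I_d -> 'I_(n.*2.+1)}].

Lemma mem_ball_seq n x : (l1 x <= n)%N -> x \in ball_seq n.
Proof.
move=> xn; have xi i : (absz (x 0%R i) <= n)%N.
  by apply: leq_trans xn; rewrite /l1 (bigD1 i)//= leq_addr.
apply/mapP; exists [ffun i => inord (absz (x 0%R i + n%:Z))].
  by rewrite mem_enum.
apply/rowP => i; rewrite mxE ffunE; have := xi i; rewrite inordK.
  by move: (x _ _) => a; lia.
by move: (xi i); move: (x _ _) => a; lia.
Qed.

Lemma size_ball_seq n : size (ball_seq n) = (n.*2.+1 ^ d)%N.
Proof. by rewrite size_map -cardE card_ffun !card_ord. Qed.

End l1_norm.

(** * Stable sets *)

Section hulls.
Context {R : realType} {d : nat} {I : finType} (i0 : I).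
Variables (L : I -> 'rV[int]_d -> R) (Lam : R).
Hypothesis LD : forall i x y, L i (x + y) = L i x + L i y.
Hypothesis Lsum : forall x, \sum_i L i x = 0.
Hypothesis Llip : forall i x, `|L i x| <= Lam * (l1 x)%:R.

Let LB i x y : L i (x - y) = L i x - L i y.
Proof. by apply/eqP; rewrite eq_sym subr_eq -LD subrK. Qed.

Definition lip (e : R) (f : 'rV[int]_d -> R) :=
  forall x y : 'rV[int]_d, f x <= f y + e * (l1d x y)%:R.

(** The offsets [phi] may change with the centre [c], so that distant components of [K] can have
    unrelated descriptions. *)
Definition locally_hull (H : nat) (e : R) (K : 'rV[int]_d -> Prop) :=
  forall c : 'rV[int]_d,
  exists2 phi : I -> 'rV[int]_d -> R, forall i, lip e (phi i) &
    forall x : 'rV[int]_d, (l1d x c <= H)%N ->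
      (K x <-> forall i, L i x <= phi i x).

(** The constant offsets -1 cut out nothing, since the [L i x] sum to 0. *)
Lemma locally_hull0 H e : 0 <= e -> locally_hull H e (fun=> False).
Proof.
move=> e0 c; exists (fun _ _ => -1) => [i x y|x _].
  by rewrite lerDl mulr_ge0.
split=> // h; have : \sum_i L i x <= \sum_(i : I) (-1) by apply: ler_sum.
rewrite Lsum sumr_const mulNrn oppr_ge0 lern0 => /eqP I0.
by have := card0_eq I0 i0; rewrite inE.
Qed.

(** If [x + U] lies in [K], then for each [i] some [z] in [U] raises [L i] by at least [g], while
    [phi i] varies by at most [e * r <= g] from [x] to [x + z]; so the constraint [i] at [x + z]
    implies the one at [x]. *)
Lemma bp_locally_hull (X : {fset {fset 'rV[int]_d}}) (g e : R) (r H : nat)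
    (K : 'rV[int]_d -> Prop) (w : config 'rV[int]_d) :
  (forall U z, U \in X -> z \in U -> (l1 z <= r)%N) ->
  (forall U i, U \in X -> exists2 z, z \in U & g <= L i z) ->
  0 <= e -> e * r%:R <= g -> (r <= H)%N -> locally_hull H e K ->
  (forall x, w x -> K x) -> forall t x, bp X w t x -> K x.
Proof.
move=> Xr Xg e0 eg rH HK wK; elim=> [|t IH] x; first exact: wK.
rewrite /bp iterS -/(bp X w t) /bp_step => /orP[/IH//|/hasP[U UX /allP UK]].
have [phi philip phiK] := HK x.
apply/phiK; first by rewrite /l1d subrr l1_0.
move=> i; have [z zU gz] := Xg U i UX.
have zr := Xr _ _ UX zU.
have xz : x + z - x = z by rewrite addrC addrA addNr add0r.
have : L i (x + z) <= phi i (x + z).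
  apply: (phiK _ _).1; last by apply: IH; exact: UK.
  by rewrite /l1d xz (leq_trans zr).
have := philip i (x + z) x; rewrite /l1d xz LD.
have : e * (l1 z)%:R <= e * r%:R by rewrite ler_wpM2l// ler_nat.
lra.
Qed.

(* Near p, K' is {x | L i x <= max (phi i x) (psi i x) for all i}, where phi
   describes K and the cone psi i x = L i p + C D - e' |x - p| covers the ball
   of radius D. As e' > e, psi <= phi at distance rho from p if K comes near p;
   otherwise the part below psi is a separate component. *)
Lemma locally_hull_extend (K P : 'rV[int]_d -> Prop) (e e' : R)
    (H h D r rho : nat) :
  0 <= Lam -> 0 <= e -> e < e' -> e' <= 1 ->
  (Lam + 1) * D%:R <= e' * r%:R ->
  (Lam + 1) * (D + r + h.*2)%:R <= (e' - e) * rho%:R ->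
  (rho + h.*2 <= H)%N -> locally_hull H e K ->
  (forall p q : 'rV[int]_d, P p -> P q ->
    (l1d p q <= (rho + h).*2)%N -> p = q) ->
  exists K' : 'rV[int]_d -> Prop, [/\ locally_hull h e' K',
    forall x, K x -> K' x,
    forall p x : 'rV[int]_d, P p -> (l1d x p <= D)%N -> K' x &
    forall x, K' x -> K x \/ exists2 p, P p & (l1d x p <= rho)%N].
Proof.
move=> L0 e0 ee e1 Dr Drho rhoH HK sepP.
have e'0 : 0 < e' by exact: le_lt_trans ee.
have D_r : (D <= r)%N.
  rewrite -(ler_nat R) -(ler_pM2l e'0); apply: le_trans Dr.
  have : 0 <= D%:R :> R by []; nra.
have r_rho : (r <= rho)%N.
  rewrite -(ler_nat R); have := Drho; rewrite !natrD.
  have : 0 <= D%:R :> R by [].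
  have : 0 <= h.*2%:R :> R by [].
  have : 0 <= r%:R :> R by [].
  have : 0 <= rho%:R :> R by [].
  move: D%:R h.*2%:R r%:R rho%:R => a b c f; nra.
have {}HK : forall c : 'rV[int]_d, exists phi : I -> 'rV[int]_d -> R,
    (forall i, lip e (phi i)) /\
    forall x : 'rV[int]_d, (l1d x c <= H)%N ->
      (K x <-> forall i, L i x <= phi i x).
  by move=> c; have [phi ? ?] := HK c; exists phi.
have {HK} [phi phiP] := choice HK.
pose psi (p : 'rV[int]_d) i (x : 'rV[int]_d) :=
  L i p + (Lam + 1) * D%:R - e' * (l1d x p)%:R.
pose near (p : 'rV[int]_d) := exists2 y, K y & (l1d y p <= r + h.*2)%N.
pose theta p i x :=
  if `[< near p >] then Num.max (phi p i x) (psi p i x) else psi p i x.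
pose W p x := forall i, L i x <= theta p i x.
have psi_lip p i : lip e' (psi p i).
  move=> x y; rewrite /psi.
  have : e' * (l1d y p)%:R <= e' * ((l1d x y)%:R + (l1d x p)%:R).
    rewrite ler_wpM2l ?(ltW e'0)// -natrD ler_nat (l1dC x y).
    exact: l1d_tri.
  lra.
have theta_lip p i : lip e' (theta p i).
  rewrite /theta => x y; case: ifP => _; last exact: psi_lip.
  rewrite ge_max; apply/andP; split.
    apply: le_trans ((phiP p).1 i x y) _.
    have : e * (l1d x y)%:R <= e' * (l1d x y)%:R.
      by rewrite ler_wpM2r// ltW.
    have : phi p i y <= Num.max (phi p i y) (psi p i y) by rewrite le_max lexx.
    lra.
  apply: le_trans (psi_lip p i x y) _; rewrite lerD2r.
  by rewrite le_max lexx orbT.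
(* The constraints bound every [L i (x - p)] by [(Lam + 1) * D - e' * |x - p|], which cannot be
   negative because the left sides sum to 0. *)
have psi_ball (p x : 'rV[int]_d) :
    (forall i, L i x <= psi p i x) -> (l1d x p <= r)%N.
  move=> xQ; rewrite -(ler_nat R) -(ler_pM2l e'0); apply: le_trans Dr.
  rewrite leNgt; apply/negP => lt.
  have : \sum_i L i (x - p) < 0.
    rewrite (bigD1 i0)//= addrC -[ltRHS]addr0 ler_ltD//.
      apply: sumr_le0 => i _; rewrite LB; have := xQ i; rewrite /psi; lra.
    by rewrite LB; have := xQ i0; rewrite /psi; lra.
  by rewrite Lsum ltxx.
(* A point [y] of [K] near [p] gives [phi p i x >= L i y - e * |x - y|]. The steeper slope [e'] of
   [psi] makes up for the loss in passing from [y] to [p] once [|x - p| >= rho]. *)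
have psi_phi (p : 'rV[int]_d) i (x : 'rV[int]_d) :
    near p -> (rho <= l1d x p)%N ->
    psi p i x <= phi p i x.
  move=> [y Ky yp] xp.
  have yH : (l1d y p <= H)%N.
    by apply: leq_trans yp _; apply: leq_trans rhoH; rewrite leq_add2r.
  have Ly := ((phiP p).2 y yH).1 Ky i.
  have := (phiP p).1 i y x.
  have := Llip i (y - p); rewrite -/(l1d y p) LB ler_norml => /andP[+ _].
  have : e * (l1d y x)%:R <= e * ((l1d y p)%:R + (l1d x p)%:R).
    rewrite ler_wpM2l// -natrD ler_nat (l1dC x p).
    exact: l1d_tri.
  have : (l1d y p)%:R <= (r + h.*2)%:R :> R by rewrite ler_nat.
  have : rho%:R <= (l1d x p)%:R :> R by rewrite ler_nat.
  rewrite /psi; move: Drho Ly; rewrite !natrD.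
  have : 0 <= (l1d y p)%:R :> R by [].
  move: (l1d y p)%:R (l1d y x)%:R (l1d x p)%:R => s u n.
  have : 0 <= D%:R :> R by [].
  move: D%:R h.*2%:R r%:R rho%:R => a b c f a0 s0 D1 Ly fn sr.
  have : (e' - e) * f <= (e' - e) * n by rewrite ler_wpM2l// subr_ge0 ltW.
  have : (Lam + e) * s <= (Lam + 1) * (c + b) by apply: ler_pM => //; lra.
  nra.
have KW (p x : 'rV[int]_d) : near p -> (l1d x p <= H)%N -> K x -> W p x.
  move=> np xp Kx i; rewrite /theta asboolT// le_max.
  by rewrite ((phiP p).2 x xp).1.
have rhH : (r + h.*2 <= H)%N by apply: leq_trans rhoH; rewrite leq_add2r.
exists (fun x => K x \/ exists p, [/\ P p, (l1d x p <= rho)%N & W p x]).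
split; first last.
- move=> x [Kx|[p [Pp xp _]]]; [by left|by right; exists p].
- move=> p x Pp xp; right; exists p; split=> //.
    by rewrite (leq_trans xp)// (leq_trans D_r).
  move=> i; apply: (@le_trans _ _ (psi p i x)).
    have := Llip i (x - p); rewrite -/(l1d x p) LB ler_norml => /andP[_].
    have : (l1d x p)%:R <= D%:R :> R by rewrite ler_nat.
    rewrite /psi; have : 0 <= (l1d x p)%:R :> R by [].
    move: (l1d x p)%:R D%:R => s a; nra.
  by rewrite /theta; case: ifP => // _; rewrite le_max lexx orbT.
- by move=> x; left.
move=> c.
(* Away from [P] nothing was added to [K] in the ball around [c]; otherwise the separation of [P]
   leaves a single relevant [p]. *)
have [[p Pp pc]|np] := pselect (exists2 p, P p & (l1d c p <= rho + h)%N);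
    last first.
  exists (phi c) => [i x y|x xc].
    apply: le_trans ((phiP c).1 i x y) _; rewrite lerD2l.
    by rewrite ler_wpM2r// ltW.
  have xcH : (l1d x c <= H)%N by lia.
  split=> [[Kx|[p [Pp xp _]]]|/((phiP c).2 x xcH).2]; [| |by left].
    exact: ((phiP c).2 x xcH).1.
  case: np; exists p => //.
  by have := l1d_tri x c p; rewrite (l1dC c x); lia.
have onlyp (x : 'rV[int]_d) : (l1d x c <= h)%N ->
    (K x \/ exists p, [/\ P p, (l1d x p <= rho)%N & W p x]) <->
    (K x \/ (l1d x p <= rho)%N /\ W p x).
  move=> xc; split=> [[?|[q [Pq xq Wq]]]|[?|[? ?]]]; [by left| |by left|].
    suff -> : p = q by right.
    apply: sepP => //; rewrite -addnn.
    have := l1d_tri c p q; rewrite (l1dC p c).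
    by have := l1d_tri x c q; rewrite (l1dC c x); lia.
  by right; exists p.
have [np|fp] := pselect (near p).
  exists (theta p) => [i|x xc]; first exact: theta_lip.
  have xp : (l1d x p <= H)%N.
    by have := l1d_tri c x p; lia.
  rewrite onlyp//; split=> [[Kx|[_ //]]|Wx]; first exact: KW.
  have [xr|xr] := leqP (l1d x p) rho; first by right.
  left; apply/((phiP p).2 x xp) => i; have := Wx i.
  by rewrite /theta asboolT// max_l// psi_phi// ltnW.
(* With [K] far from [p], the ball of radius [h] around [c] misses either [K] (close to [p]) or the
   component at [p], which has radius at most [r]. *)
have [pr|pr] := leqP (l1d c p) (r + h).
  exists (theta p) => [i|x xc]; first exact: theta_lip.
  rewrite onlyp//; split=> [[Kx|[_ //]]|Wx].
    by case: fp; exists x => //; have := l1d_tri c x p; lia.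
  right; split=> //; apply: leq_trans r_rho; apply: psi_ball => i.
  by have := Wx i; rewrite /theta asboolF.
exists (phi c) => [i x y|x xc].
  apply: le_trans ((phiP c).1 i x y) _; rewrite lerD2l.
  by rewrite ler_wpM2r// ltW.
have xcH : (l1d x c <= H)%N by lia.
rewrite onlyp//; split=> [[Kx|[_ Wx]]|/((phiP c).2 x xcH).2]; [| |by left].
  exact: ((phiP c).2 x xcH).1.
have : (l1d x p <= r)%N.
  by apply: psi_ball => i; have := Wx i; rewrite /theta asboolF.
by have := l1d_tri x c p; rewrite (l1dC c x); lia.
Qed.

End hulls.

(** * Sparse sets *)

Section levels.
Context {d : nat}.
Variables (b H : nat -> nat).
Hypothesis b0 : (0 < b 0)%N.
Hypothesis bS : forall k, (b k + (H k).*2 <= b k.+1)%N.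
Hypothesis bH : forall k, ((b k).*2 <= H k)%N.
Implicit Types (A : 'rV[int]_d -> Prop) (a c : 'rV[int]_d).

(* The points of level k that are not of level k.+1 form clusters of diameter
   b k at mutual distance H k. *)
Fixpoint level A (k : nat) a : Prop :=
  if k is j.+1 then
    level A j a /\
    exists2 c, level A j c & (b j < l1d a c <= H j)%N
  else A a.

Let b_gt k : (k < b k)%N.
Proof. by elim: k => [//|k IH]; have := bS k; have := bH k; lia. Qed.

Lemma level_sub A k a : level A k a -> A a.
Proof. by elim: k => [//|k IH] /= [/IH]. Qed.

(** Level [j.+1] requires two points of [A] at distance more than [b j > j]; for [j = M.*2] this
    exceeds the diameter. *)
Lemma level_bounded A M :
  (forall a, A a -> (l1 a <= M)%N) -> forall a, ~ level A (M.*2.+1) a.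
Proof.
move=> AM a [/level_sub/AM aM [c /level_sub/AM cM]].
have := b_gt M.*2; have := l1D a (- c); rewrite l1N -/(l1d a c); lia.
Qed.

Lemma l1dxx a : l1d a a = 0%N.
Proof. by rewrite /l1d subrr l1_0. Qed.

Let isolated A k a := level A k a /\ ~ level A k.+1 a.

Let isolatedP A k a c : isolated A k a -> level A k c ->
  (l1d a c <= H k)%N -> (l1d a c <= b k)%N.
Proof.
move=> [la na] lc acH; rewrite leqNgt; apply/negP => acb; apply: na.
by split=> //; exists c => //; rewrite acb.
Qed.

(** Isolated points within [H k] of each other are within [b k], and as [2 b k <= H k] this is an
    equivalence relation. [choose] depends only on the extension of the predicate, so it picks one
    common representative per class. *)
Lemma island_centers A k : exists P : 'rV[int]_d -> Prop,
  [/\ forall p, P p -> level A k p,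
   forall p q, P p -> P q -> (l1d p q <= H k)%N -> p = q &
   forall a, level A k a -> ~ level A k.+1 a ->
     exists2 p, P p & (l1d a p <= b k)%N].
Proof.
pose Q a c := `[< isolated A k c /\ (l1d c a <= b k)%N >].
pose rep a := choose (Q a) a.
have Qaa a : isolated A k a -> Q a a.
  by move=> ia; apply/asboolP; rewrite l1dxx.
have repE a c : isolated A k a -> isolated A k c -> (l1d a c <= H k)%N ->
    rep a = rep c.
  move=> ia ic acH; have ac := isolatedP ia ic.1 acH.
  have Qac : Q a =1 Q c.
    move=> x; apply/asboolP/asboolP => -[ix xa]; split=> //;
      apply: (isolatedP ix); [exact: ic.1| |exact: ia.1|].
      by have := l1d_tri a x c; have := bH k; move=> *; lia.
    by have := l1d_tri c x a; rewrite (l1dC c a); have := bH k; move=> *; lia.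
  rewrite /rep (eq_choose Qac); apply: choose_id; last exact: Qaa.
  by rewrite -Qac; exact: Qaa.
exists (fun p => isolated A k p /\ rep p = p); split.
- by move=> p [[]].
- by move=> p q [ip rp] [iq rq] pq; rewrite -rp -rq; exact: repE.
- move=> a la na; have ia : isolated A k a by [].
  have /asboolP[ir ra] := chooseP (Qaa a ia); exists (rep a).
    split=> //; apply/esym/repE => //.
    by rewrite l1dC; apply: leq_trans ra _; have := bH k; lia.
  by rewrite l1dC.
Qed.

(* The condition on the cardinality keeps the disjoint unions only. *)
Fixpoint trees (k : nat) a : seq {fset 'rV[int]_d} :=
  if k is j.+1 then
    [seq V <- [seq (V `|` V')%fset | V <- trees j a,
       V' <- flatten [seq trees j (a + y) | y <- ball_seq (H j)]] |
     #|` V| == (2 ^ k)%N]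
  else [:: [fset a]%fset].

Lemma card_trees k a V : V \in trees k a -> #|` V| = (2 ^ k)%N.
Proof.
case: k => [|k] /=; first by rewrite inE => /eqP ->; rewrite cardfs1.
by rewrite mem_filter => /andP[/eqP].
Qed.

(** A point of level [k.+1] has a partner of level [k] more than [b k] away. Their trees reach at
    most [b k / 2] from the roots, so they are disjoint and the cardinality doubles. *)
Lemma level_trees A k a : level A k a -> exists V, [/\ V \in trees k a,
  forall s, s \in V -> A s & forall s, s \in V -> ((l1d s a).*2 <= b k)%N].
Proof.
elim: k a => [|k IH] a.
  move=> Aa; exists [fset a]%fset; split; first by rewrite inE.
    by move=> s; rewrite inE => /eqP ->.
  by move=> s; rewrite inE => /eqP ->; rewrite l1dxx.
move=> [la [c lc /andP[bac acH]]].
have [V [VT VA Vb]] := IH a la; have [V' [VT' VA' Vb']] := IH c lc.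
exists (V `|` V')%fset; split.
- rewrite /= mem_filter; apply/andP; split.
    apply/eqP; rewrite cardfsU (card_trees VT) (card_trees VT').
    suff /eqP -> : (V `&` V' == fset0)%fset.
      by rewrite cardfs0 subn0 addnn -mul2n -expnS.
    rewrite -/(fdisjoint V V'); apply/fdisjointP => s sS; apply/negP => sV'.
    have := Vb s sS; have := Vb' s sV'; have := l1d_tri s a c.
    by rewrite (l1dC a s); lia.
  apply/allpairsP; exists (V, V'); split=> //=.
  apply/flattenP; exists (trees k c) => //; apply/mapP; exists (c - a).
    by apply: mem_ball_seq; rewrite -/(l1d c a) l1dC.
  by rewrite addrC subrK.
- by move=> s; rewrite inE => /orP[]; [exact: VA|exact: VA'].
- move=> s; rewrite inE; have := bS k; have := bH k => ? ? /orP[/Vb|/Vb'].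
    lia.
  by have := l1d_tri c s a; rewrite (l1dC c a); lia.
Qed.

Fixpoint ntrees (k : nat) : nat :=
  if k is j.+1 then ((H j).*2.+1 ^ d * ntrees j ^ 2)%N else 1%N.

Lemma size_trees k a : (size (trees k a) <= ntrees k)%N.
Proof.
elim: k a => [//|k IH] a /=.
rewrite size_filter; apply: leq_trans (count_size _ _) _.
rewrite size_allpairs size_flatten /shape -map_comp.
have : (sumn (map (size \o (fun y => trees k (a + y))%R) (ball_seq (H k))) <=
    (H k).*2.+1 ^ d * ntrees k)%N.
  rewrite -size_ball_seq; elim: (ball_seq _) => //= y s IHs.
  by rewrite mulSn leq_add.
move=> hk; apply: leq_trans (leq_mul (IH a) hk) _.
by rewrite mulnCA mulnn.
Qed.

Section confinement.
Context {R : realType} {I : finType} (i0 : I).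
Variables (L : I -> 'rV[int]_d -> R) (Lam : R).
Hypothesis LD : forall i x y, L i (x + y) = L i x + L i y.
Hypothesis Lsum : forall x, \sum_i L i x = 0.
Hypothesis Llip : forall i x, `|L i x| <= Lam * (l1 x)%:R.
Hypothesis Lam0 : 0 <= Lam.
Variables (e : nat -> R) (r rho : nat -> nat).
Hypothesis e0 : forall k, 0 <= e k.
Hypothesis eS : forall k, e k.+1 < e k.
Hypothesis e1 : forall k, e k <= 1.
Hypothesis er : forall k, (Lam + 1) * (b k)%:R <= e k * (r k)%:R.
Hypothesis erho : forall k,
  (Lam + 1) * (b k + r k + (b k).*2)%:R <= (e k - e k.+1) * (rho k)%:R.
Hypothesis brho : forall k, (rho k + (b k).*2 <= b k.+1)%N.
Hypothesis Hrho : forall k, ((rho k + b k).*2 <= H k)%N.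

(** Downward induction on the level, starting from the empty set at level [N]. Passing from [k.+1]
    to [k] covers the islands of level [k] by [locally_hull_extend] with [D = h = b k], [H = b k.+1]
    and slopes [e k.+1 < e k]. *)
Lemma level_cover A N : (forall a, ~ level A N a) ->
  exists K : 'rV[int]_d -> Prop, [/\ locally_hull L (b 0) (e 0) K,
    forall x, A x -> K x &
    forall x, K x -> exists k a, [/\ (k < N)%N, level A k a &
      (l1d x a <= rho k)%N]].
Proof.
move=> AN; suff : forall n k, (k + n = N)%N ->
    exists K : 'rV[int]_d -> Prop, [/\ locally_hull L (b k) (e k) K,
      forall x, level A k x -> K x &
      forall x, K x -> exists j a, [/\ (j < N)%N, level A j a &
        (l1d x a <= rho j)%N]].
  by move=> /(_ N 0%N); exact.
elim=> [|n IH] k.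
  rewrite addn0 => ->; exists (fun=> False); split=> //.
  exact: locally_hull0.
rewrite -addSnnS => kN; have [K [HK Klev KN]] := IH _ kN.
have [P [Plev Psep Pisl]] := island_centers A k.
have Psep' p q : P p -> P q -> (l1d p q <= (rho k + b k).*2)%N -> p = q.
  by move=> Pp Pq pq; apply: Psep => //; exact: leq_trans (Hrho k).
have [K' [HK' KK' PK' KP]] := locally_hull_extend i0 LD Lsum Llip Lam0
  (e0 k.+1) (eS k) (e1 k) (er k) (erho k) (brho k) HK Psep'.
exists K'; split=> // [x lx|x /KP[/KN//|[p Pp xp]]].
  have [lx'|nlx] := pselect (level A k.+1 x); first exact/KK'/Klev.
  by have [p Pp xp] := Pisl _ lx nlx; exact: (PK' p).
by exists k, p; split=> //; [lia|exact: Plev].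
Qed.

End confinement.
End levels.

(** * Bernoulli product measures *)

Section bernoulli_product_theory.
Context {R : realType} {I : countType}.

Lemma measurable_coordinate (i : I) : measurable [set w : config I | w i].
Proof. by apply: sub_sigma_algebra; exists i. Qed.

Lemma measurable_has (T : Type) (B : T -> config I -> bool) (s : seq T) :
  (forall t, measurable [set w | B t w]) ->
  measurable [set w | has (B^~ w) s].
Proof.
move=> mB; elim: s => [|t s IH] /=.
  by rewrite (_ : [set _ | _] = set0)//; apply/seteqP; split.
rewrite (_ : [set _ | _] = [set w | B t w] `|` [set w | has (B^~ w) s]).
  exact: measurableU.
by apply/seteqP; split=> w /= /orP.
Qed.

Lemma measurable_all (T : Type) (B : T -> config I -> bool) (s : seq T) :
  (forall t, measurable [set w | B t w]) ->
  measurable [set w | all (B^~ w) s].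
Proof.
move=> mB; elim: s => [|t s IH] /=.
  by rewrite (_ : [set _ | _] = setT)//; apply/seteqP; split.
rewrite (_ : [set _ | _] = [set w | B t w] `&` [set w | all (B^~ w) s]).
  exact: measurableI.
by apply/seteqP; split=> w /= /andP.
Qed.

Lemma measurable_negb (B : config I -> bool) :
  measurable [set w | B w] -> measurable [set w | ~~ B w].
Proof.
move=> mB; rewrite (_ : [set _ | _] = ~` [set w | B w]).
  exact: measurableC.
by apply/seteqP; split=> w /= /negP.
Qed.

Variable q : R.
Hypothesis q01 : 0 <= q <= 1.
Let mu := bernoulli_product I q.

Let measurable_fset (V : {fset I}) : measurable [set w : config I | all w V].
Proof.
by apply: (@measurable_all I (fun i w => w i)); exact: measurable_coordinate.
Qed.

Lemma bernoulli_product_all (V : {fset I}) :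
  mu [set w : config I | all w V] = (q ^+ #|` V|)%:E.
Proof.
rewrite (_ : [set _ | _] =
    [set w : config I | forall i, i \in V -> w i = true]); last first.
  by apply/seteqP; split=> w /= /allP.
rewrite (bernoulli_productP q01 V (fun=> true)) big_const_seq count_predT.
by congr EFin; elim: (size _) => //= n ->; rewrite exprS.
Qed.

Lemma bernoulli_product_union_bound (F : seq {fset I}) (E : set (config I)) :
  measurable E -> (forall w, E w -> exists2 V, V \in F & all w V) ->
  (mu E <= (\sum_(V <- F) q ^+ #|` V|)%:E)%E.
Proof.
move=> mE EF.
have mF F' :
    measurable [set w : config I | has (fun V : {fset I} => all w V) F'].
  exact: (@measurable_has _ (fun V w => all w (enum_fset V))).
apply: (@le_trans _ _
    (mu [set w : config I | has (fun V : {fset I} => all w V) F])).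
  apply: le_measure; rewrite ?inE//.
  by move=> w /EF[V VF wV]; apply/hasP; exists V.
elim: F {EF} => [|V F IH].
  by rewrite big_nil (_ : [set _ | _] = set0) ?measure0//; apply/seteqP; split.
rewrite big_cons EFinD -bernoulli_product_all.
rewrite (_ : [set _ | _] = [set w : config I | all w V] `|`
    [set w : config I | has (fun V : {fset I} => all w V) F]); last first.
  by apply/seteqP; split=> w /= /orP.
apply: le_trans (leeD2l _ IH).
exact: measureU2.
Qed.

(** Pairwise disjointness, with [V] accumulating the blocks already met. *)
Fixpoint fdisjoints (V : {fset I}) (Bs : seq {fset I}) : bool :=
  if Bs is B :: Bs' then
    fdisjoint V B && fdisjoints (V `|` B)%fset Bs'
  else true.

Lemma fdisjointsS V V' Bs : (V' `<=` V)%fset -> fdisjoints V Bs ->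
  fdisjoints V' Bs.
Proof.
elim: Bs V V' => [//|B Bs IH] V V' sV /= /andP[VB dBs].
rewrite (fdisjointWl sV VB) /=; apply: IH dBs.
exact: fsetSU.
Qed.

Lemma measurable_blocks (V : {fset I}) (Bs : seq {fset I}) :
  measurable [set w : config I |
    all w V && all (fun B : {fset I} => ~~ all w B) Bs].
Proof.
rewrite (_ : [set _ | _] = [set w : config I | all w V] `&`
    [set w : config I | all (fun B : {fset I} => ~~ all w B) Bs]).
  apply: measurableI => //.
  apply: (@measurable_all _ (fun (B : {fset I}) w => ~~ all w B)) => B'.
  exact: measurable_negb.
by apply/seteqP; split=> w /= /andP.
Qed.

(** The event that [B] is not full is a difference of the events for [V] and for [V] united with
    [B]. Carrying [V] thus reduces independence to the probabilities of full sets. *)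
Lemma bernoulli_product_blocks (n : nat) (V : {fset I}) (Bs : seq {fset I}) :
  fdisjoints V Bs -> (forall B, B \in Bs -> #|` B| = n) ->
  mu [set w : config I | all w V && all (fun B : {fset I} => ~~ all w B) Bs] =
  (q ^+ #|` V| * (1 - q ^+ n) ^+ size Bs)%:E.
Proof.
elim: Bs V => [|B Bs IH] V.
  move=> _ _; rewrite expr0 mulr1 -bernoulli_product_all; congr (mu _).
  by apply/seteqP; split=> w /=; rewrite andbT.
move=> /= /andP[VB dBs] Bn.
pose ev (V : {fset I}) := [set w : config I |
  all w V && all (fun B : {fset I} => ~~ all w B) Bs].
have mev V' : measurable (ev V') by exact: measurable_blocks.
have allU w : all w (V `|` B)%fset = all w V && all w B.
  apply/allP/andP => [h|[/allP hV /allP hB] x].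
    by split; apply/allP => x xV; apply: h; rewrite inE xV ?orbT.
  by rewrite inE => /orP[/hV|/hB].
rewrite (_ : [set _ | _] = ev V `\` ev (V `|` B)%fset); last first.
  apply/seteqP; split=> w /=; rewrite /ev /= allU.
    by move=> /and3P[-> /negbTE -> ->].
  by move=> [/andP[-> ->] /=]; rewrite andbT => /negP ->.
have Bn' B' : B' \in Bs -> #|` B'| = n.
  by move=> BB; apply: Bn; rewrite inE BB orbT.
have -> : mu (ev V `\` ev (V `|` B)%fset) =
    (mu (ev V) - mu (ev V `&` ev (V `|` B)%fset))%E.
  by apply: measureD => //; rewrite -ge0_fin_numE// fin_num_measure.
rewrite setIidr; last first.
  by move=> w; rewrite /ev /= allU -andbA => /and3P[-> _ ->].
have evE V' : fdisjoints V' Bs ->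
    mu (ev V') = (q ^+ #|` V'| * (1 - q ^+ n) ^+ size Bs)%:E.
  by move=> dV'; exact: IH.
rewrite !evE//; last exact: fdisjointsS (fsubsetUl _ _) dBs.
have -> : #|` (V `|` B)%fset| = (#|` V| + n)%N.
  rewrite cardfsU (eqP VB) cardfs0 subn0 (Bn B)// inE eqxx//.
by rewrite -EFinB exprS exprD; congr EFin; ring.
Qed.

End bernoulli_product_theory.

(** * Criteria for the positivity of the critical density *)

Section threshold.
Context {R : realType} {d : nat} (X : {fset {fset 'rV[int]_d}}).

Lemma measurable_bp t x : measurable [set w | bp X w t x].
Proof.
elim: t x => [|t IH] x; first exact: measurable_coordinate.
rewrite (_ : [set _ | _] = [set w | bp X w t x] `|` [set w | has
    (fun U : {fset 'rV[int]_d} => all (fun y => bp X w t (x + y)) U) X]).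
  apply: measurableU => //.
  apply: (@measurable_has _ _
    (fun (U : {fset 'rV[int]_d}) w => all (fun y => bp X w t (x + y)) U)) => U.
  exact: (@measurable_all _ _ (fun y w => bp X w t (x + y))).
by apply/seteqP; split=> w /= /orP.
Qed.

Let healthy t := [set w | bp X w t 0 != true].

Let healthyE t : healthy t = ~` [set w | bp X w t 0].
Proof. by apply/seteqP; split=> w /=; rewrite /healthy /= eqb_id => /negP. Qed.

Let measurable_healthy t : measurable (healthy t).
Proof. by rewrite healthyE; apply: measurableC; exact: measurable_bp. Qed.

(** The origin stays healthy with probability at least 1/2 at each time, so no density up to [q0]
    belongs to the set defining [q_c]. *)
Lemma subcritical_criterion (q0 : R) : 0 < q0 ->
  (forall (q : R) t, 0 <= q <= 1 -> q <= q0 ->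
    (bernoulli_product 'rV[int]_d q [set w | bp X w t 0%R] <= (2^-1)%:E)%E) ->
  subcritical R X.
Proof.
move=> q00 half; apply: (lt_le_trans q00); apply: lb_le_inf.
  (* The set under the infimum must be nonempty: it contains 1, since a healthy origin was healthy
     initially, an event of probability 0 at density 1. *)
  exists 1; split; first by rewrite ler01 lexx.
  apply: cvg_near_cst; apply: nearW => t.
  have q01 : 0 <= (1 : R) <= 1 by rewrite ler01 lexx.
  apply/eqP; rewrite eq_le measure_ge0 andbT.
  have := bernoulli_productP q01 [fset (0 : 'rV[int]_d)]%fset (fun=> false).
  rewrite big_seq_fset1 /bernoulli_pmf subrr => h0.
  apply: le_trans (eq_ind _ (fun z => z <= 0)%E (lexx 0%E) _ (esym h0)).
  apply: le_measure; rewrite ?inE; first exact: measurable_healthy.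
    rewrite (_ : [set _ | _] = [set w : config 'rV[int]_d | ~~ w 0]).
      apply: (@measurable_negb _ (fun w => w 0)).
      exact: measurable_coordinate.
    apply/seteqP; split=> w /=; first by move=> /(_ 0); rewrite inE eqxx => ->.
    by move=> w0 i; rewrite inE => /eqP ->; exact: negbTE.
  move=> w /= wt i; rewrite inE => /eqP ->.
  apply/negbTE; apply: contra wt => w0.
  rewrite eqb_id; elim: t => [//|t IH].
  by rewrite /bp iterS -/(bp X w t) /bp_step IH.
move=> q /= [q01 cvg0]; rewrite leNgt; apply/negP => qq0.
have h0 : 0 < (2^-1 : R) by rewrite invr_gt0.
have /fine_cvgP[_ /cvgrPdist_lt /(_ _ h0) [N _ /(_ N (leqnn N))]] := cvg0.
rewrite /= sub0r normrN ger0_norm ?fine_ge0//.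
have := half q N q01 (ltW qq0).
have <- : (1 - bernoulli_product 'rV[int]_d q (healthy N))%E =
    bernoulli_product 'rV[int]_d q [set w | bp X w N 0].
  by rewrite -probability_setC// healthyE setCK.
rewrite -/(healthy N).
rewrite -[X in (1 - X <= _)%E]fineK ?fin_num_measure//.
by rewrite -EFinB lee_fin; lra.
Qed.

(** Disjoint blocks are independent, so all [N] of them fail to be full with probability
    [(1 - q ^+ n) ^+ N], which tends to 0 for every [q > 0]. *)
Lemma not_subcritical_criterion (n : nat) :
  (forall N, exists t0 (Bs : seq {fset 'rV[int]_d}),
    [/\ fdisjoints fset0 Bs, size Bs = N, forall B, B \in Bs -> #|` B| = n &
     forall B w t, B \in Bs -> (t0 <= t)%N -> all w B -> bp X w t 0]) ->
  ~ subcritical R X.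
Proof.
move=> hN; rewrite /subcritical => qc0.
(* A positive density below [q_c], capped at 1 to remain a probability. *)
pose q := Num.min (q_c R X / 2) 1.
have q0 : 0 < q by rewrite lt_min divr_gt0//= ltr01.
have q1 : q <= 1 by rewrite ge_min lexx orbT.
have q01 : 0 <= q <= 1 by rewrite ltW.
suff : q_c R X <= q.
  by rewrite le_min => /andP[+ _]; rewrite ler_pdivlMr//; lra.
apply: ge_inf; first by exists 0 => x [/andP[]].
split=> //; apply/fine_cvgP; split.
  by apply: nearW => t; exact: fin_num_measure (measurable_healthy t).
apply/cvgrPdist_le => e e0.
have qn : `|1 - q ^+ n| < 1.
  have : q ^+ n <= 1 by rewrite exprn_ile1// ltW.
  have : 0 < q ^+ n by rewrite exprn_gt0.
  by move=> ? ?; rewrite ger0_norm; lra.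
have /cvgrPdist_lt /(_ _ e0) [N _ /(_ N (leqnn N))] := cvg_expr qn.
rewrite /= sub0r normrN => Ne.
have [t0 [Bs [dBs sBs nBs infBs]]] := hN N.
exists t0 => // t /= t0t.
rewrite sub0r normrN ger0_norm ?fine_ge0//.
apply: le_trans (ltW Ne); apply: le_trans (ler_norm _).
rewrite -lee_fin fineK; last exact: fin_num_measure (measurable_healthy t).
have := bernoulli_product_blocks q01 dBs nBs.
rewrite cardfs0 expr0 mul1r sBs => <-.
apply: le_measure; rewrite ?inE//; first exact: measurable_healthy.
  exact: measurable_blocks.
move=> w /= wt; rewrite /= ; apply/allP => B BB.
by apply: contra wt => wB; rewrite eqb_id; exact: infBs wB.
Qed.

End threshold.

(** * Eroders *)

Section inner_product.
Context {R : realType} {d : nat}.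
Implicit Types (x y : 'rV[int]_d) (u v : 'rV[R]_d).

Lemma innerD x y u : inner (x + y) u = inner x u + inner y u.
Proof.
rewrite /inner -big_split /=; apply: eq_bigr => i _.
by rewrite mxE intrD mulrDl.
Qed.

Lemma inner_le_l1 x u (c : R) :
  (forall i, `|u 0 i| <= c) -> `|inner x u| <= c * (l1 x)%:R.
Proof.
move=> uc; apply: le_trans (ler_norm_sum _ _ _) _.
rewrite /l1 natr_sum mulr_sumr; apply: ler_sum => i _.
by rewrite normrM mulrC -intr_norm -natr_absz; apply: ler_wpM2r.
Qed.

End inner_product.

(** As [e] is halved at each scale, [r] must be of order [2^k b k], and [rho] and [H] of order
    [4^k b k]. The ratio [Q ^ k.+1] of successive [b] leaves room for them, yet keeps [log (b k)]
    quadratic in [k], as the counting of trees needs. *)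
Lemma scales (R : realType) (Lam s : R) (r0 : nat) : 0 <= Lam -> 0 < s ->
  exists (e : nat -> R) (b H r rho : nat -> nat) (Q : nat),
  [/\ [/\ forall k, 0 <= e k, forall k, e k.+1 < e k, forall k, e k <= 1 &
          e 0 * r0%:R <= s],
      [/\ (0 < b 0)%N, (r0 <= b 0)%N, (1 < Q)%N &
          forall k, b k.+1 = (Q ^ k.+1 * b k)%N],
      forall k, (Lam + 1) * (b k)%:R <= e k * (r k)%:R,
      forall k, (Lam + 1) * (b k + r k + (b k).*2)%:R <=
                (e k - e k.+1) * (rho k)%:R &
      [/\ forall k, (b k + (H k).*2 <= b k.+1)%N,
          forall k, ((b k).*2 <= H k)%N,
          forall k, (rho k + (b k).*2 <= b k.+1)%N &
          forall k, ((rho k + b k).*2 <= H k)%N]].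
Proof.
move=> L0 s0.
pose e0 : R := Num.min 1 (s / r0.+1%:R).
have e00 : 0 < e0 by rewrite lt_min ltr01 divr_gt0.
have e01 : e0 <= 1 by rewrite ge_min lexx.
have es : e0 * r0%:R <= s.
  have : e0 <= s / r0.+1%:R by rewrite ge_min lexx orbT.
  rewrite ler_pdivlMr// => h; apply: le_trans h.
  by rewrite ler_wpM2l ?(ltW e00)// ler_nat.
(* [M] absorbs [(Lam + 1) / e0] in the condition on [r]; [B] below is chosen so that the condition
   on [rho] follows from the same bound. *)
pose M := Num.bound ((Lam + 1) / e0).
have eM : Lam + 1 <= e0 * M%:R.
  rewrite mulrC -ler_pdivrMr// ltW// archi_boundP// divr_ge0 ?(ltW e00)//.
  by rewrite addr_ge0.
have M0 : (0 < M)%N.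
  case: (posnP M) => // M0; move: eM; rewrite M0 mulr0; lra.
have [B BE] : exists B, B = (2 * M * (3 + M))%N by exists (2 * M * (3 + M))%N.
have B1 : (2 <= B)%N by rewrite BE; nia.
pose Q := (16 * B)%N.
pose b := fix b k := if k is j.+1 then (Q ^ j.+1 * b j)%N else r0.+1.
have bE k : b k.+1 = (Q ^ k.+1 * b k)%N by [].
have Q4 k : (16 * B * 4 ^ k <= Q ^ k.+1)%N.
  rewrite expnS leq_mul//; case: k => // k; rewrite leq_exp2r// /Q; lia.
have b_ge k : (16 * B * 4 ^ k * b k <= b k.+1)%N by rewrite bE leq_mul.
have p4 k : (0 < 4 ^ k)%N by rewrite expn_gt0.
exists (fun k => e0 / 2 ^+ k), b, (fun k => 4 * B * 4 ^ k * b k)%N,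
  (fun k => M * 2 ^ k * b k)%N, (fun k => B * 4 ^ k * b k)%N, Q.
split.
- split.
  + by move=> k; rewrite divr_ge0 ?(ltW e00)// exprn_ge0.
  + move=> k; rewrite exprS invfM mulrA ltr_pM2r ?invr_gt0 ?exprn_gt0//.
    by rewrite ltr_pdivrMr//; lra.
  + move=> k; rewrite ler_pdivrMr ?exprn_gt0// mul1r (le_trans e01)//.
    by rewrite exprn_ege1// ler1n.
  + by rewrite expr0 divr1.
- by split=> //; rewrite /Q; lia.
- move=> k; rewrite !natrM natrX.
  have -> : e0 / 2 ^+ k * (M%:R * 2 ^+ k * (b k)%:R) = e0 * M%:R * (b k)%:R.
    by field; rewrite expf_neq0.
  exact: ler_wpM2r.
- move=> k; have -> : (b k + M * 2 ^ k * b k + (b k).*2 =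
      (3 + M * 2 ^ k) * b k)%N by lia.
  have -> : (B * 4 ^ k = 2 ^ k * 2 ^ k * B)%N.
    by rewrite mulnC -expnMn.
  rewrite !natrM !natrX exprS.
  have -> : (e0 / 2 ^+ k - e0 / (2 * 2 ^+ k)) *
      (2 ^+ k * 2 ^+ k * B%:R * (b k)%:R) =
      e0 * M%:R * ((3 + M%:R) * 2 ^+ k * (b k)%:R).
    by rewrite BE !natrM natrD; field; rewrite expf_neq0.
  apply: ler_pM => //; first by rewrite addr_ge0.
  apply: ler_wpM2r => //; rewrite natrD natrM natrX mulrDl lerD2r.
  by rewrite ler_peMr// exprn_ege1// ler1n.
- have hB k : (2 * b k <= B * 4 ^ k * b k)%N.
    by rewrite leq_mul2r (leq_trans B1) ?orbT// leq_pmulr.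
  by split=> k; have := b_ge k; have := hB k; rewrite -!mulnA;
    move: (B * (4 ^ k * b k))%N => z; lia.
Qed.

(** Infection spreads by at most [r] per step. This permits truncating a random configuration to a
    bounded one, as [level_bounded] requires. *)
Lemma bp_finite_speed (d : nat) (X : {fset {fset 'rV[int]_d}}) (r M : nat) :
  (forall U z, U \in X -> z \in U -> (l1 z <= r)%N) ->
  forall (w : config 'rV[int]_d) t x, (l1 x + r * t <= M)%N ->
  bp X w t x -> bp X (fun y => w y && (l1 y <= M)%N) t x.
Proof.
move=> Xr w; elim=> [|t IH] x xM.
  by move=> wx; apply/andP; split=> //; move: xM; rewrite muln0 addn0.
rewrite /bp !iterS -!/(bp X _ t) /bp_step => /orP[wx|/hasP[U UX /allP wU]].
  by apply/orP; left; apply: IH => //; rewrite mulnS in xM; lia.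
apply/orP; right; apply/hasP; exists U => //; apply/allP => z zU.
apply: IH; last exact: wU.
by have := l1D x z; have := Xr U z UX zU; rewrite mulnS in xM; lia.
Qed.

Lemma update_family_range (d : nat) (X : {fset {fset 'rV[int]_d}}) :
  exists r, forall U z, U \in X -> z \in U -> (l1 z <= r)%N.
Proof.
exists (\max_(U <- X) \max_(z <- U) l1 z)%N => U z UX zU.
apply: (@leq_trans (\max_(z <- U) l1 z)%N).
  exact: (@leq_bigmax_seq _ _ xpredT (fun z => l1 z)).
exact: (@leq_bigmax_seq _ _ xpredT
  (fun U : {fset _} => \max_(z <- U) l1 z)%N).
Qed.

Section eroder.
Context {R : realType} {d : nat} (X : {fset {fset 'rV[int]_d}}).
Context {I : finType} (i0 : I) (u : I -> 'rV[R]_d) (s : R).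
Hypothesis usum : \sum_i u i = 0.
Hypothesis s0 : 0 < s.
Hypothesis us : forall U i, U \in X -> exists2 z, z \in U & s <= inner z (u i).

Let L i x := inner x (u i).
Let Lam := \sum_i \sum_j `|u i 0 j|.

Let LD i x y : L i (x + y) = L i x + L i y.
Proof. exact: innerD. Qed.

Let Lsum x : \sum_i L i x = 0.
Proof.
rewrite /L /inner exchange_big big1//= => j _; rewrite -mulr_sumr.
by have /matrixP/(_ 0 j) := usum; rewrite summxE mxE => ->; rewrite mulr0.
Qed.

Let Lam0 : 0 <= Lam.
Proof. by apply: sumr_ge0 => i _; apply: sumr_ge0. Qed.

Let Llip i x : `|L i x| <= Lam * (l1 x)%:R.
Proof.
apply: inner_le_l1 => j; rewrite /Lam (bigD1 i)//= (bigD1 j)//= -addrA lerDl.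
by rewrite addr_ge0// sumr_ge0// => k _; apply: sumr_ge0.
Qed.

(** For bounded [A] the levels beyond [M.*2] are empty, so [level_cover] gives a stable set
    containing [A] and close to its levels. The scales are fixed before [A]. *)
Lemma bp_near_levels : exists (b H rho : nat -> nat) (Q : nat),
  [/\ [/\ (0 < b 0)%N, (1 < Q)%N & forall k, b k.+1 = (Q ^ k.+1 * b k)%N],
      [/\ forall k, (b k + (H k).*2 <= b k.+1)%N,
          forall k, ((b k).*2 <= H k)%N &
          forall k, (rho k <= b k.+1)%N] &
   forall (A : 'rV[int]_d -> Prop) (w : config 'rV[int]_d) M,
     (forall a, A a -> (l1 a <= M)%N) -> (forall a, w a -> A a) ->
     forall t x, bp X w t x -> exists k a, [/\ (k <= M.*2)%N,
       level b H A k a & (l1d x a <= rho k)%N]].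
Proof.
have [r0 Xr] := update_family_range X.
have [e [b [H [r [rho [Q [[e0 eS e1 er0] [b0 br0 Q1 bQ] er erho
  [bS bH brho Hrho]]]]]]]] := scales r0 Lam0 s0.
exists b, H, rho, Q; split=> //.
  by split=> // k; apply: leq_trans (brho k); rewrite leq_addr.
move=> A w M AM wA t x wx.
have [K [HK AK KN]] := level_cover b0 bH i0 LD Lsum Llip Lam0 e0 eS e1
  er erho brho Hrho (fun a => @level_bounded _ _ _ b0 bS bH A M AM a).
apply: KN; apply: (bp_locally_hull LD Xr us (e0 0) er0 br0 HK) wx => y /wA.
exact: AK.
Qed.

(** Only the scales up to [M.*2] occur, and their radii do not depend on time. *)
Lemma eroder_not_supercritical : ~ supercritical X.
Proof.
have [b [H [rho [Q [_ _ near]]]]] := bp_near_levels.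
move=> [A]; apply.
pose M := (\max_(a <- A) l1 a)%N.
have AM a : a \in A -> (l1 a <= M)%N.
  by move=> aA; exact: (@leq_bigmax_seq _ _ xpredT (fun z => l1 z)).
pose N := (M + \sum_(k < M.*2.+1) rho k)%N.
apply: (@sub_finite_set _ _ [set` ball_seq (d := d) N]); last exact: finite_seq.
move=> x [t _ /= xt]; apply: mem_ball_seq.
have [k [a [kM la xa]]] := near (fun a => a \in A) _ M AM (fun a => id) t x xt.
have := AM a (level_sub la).
have := l1D (x - a) a; rewrite subrK -/(l1d x a).
have : (rho k <= \sum_(k < M.*2.+1) rho k)%N.
  by rewrite (bigD1 (Ordinal (kM : (k < M.*2.+1)%N)))//= leq_addr.
by rewrite /N; lia.
Qed.

(** An infected origin lies within [rho k] of a point of some level [k], hence a tree rooted there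
    is initially full; a union bound over roots, trees and [k] follows. *)
Lemma eroder_subcritical : subcritical R X.
Proof.
have [r0 Xr] := update_family_range X.
have [b [H [rho [Q [[b0 Q1 bQ] [bS bH brho] near]]]]] := bp_near_levels.
(* [c k] bounds the size of a cube of radius up to [b k.+1], hence the number of roots within
   [rho k] and of partners within [H k]. *)
pose c k : R := ((3 * b k.+1) ^ d)%:R.
pose n k := ntrees (d := d) H k.
(* The exponent [d.+1] makes [G >= 2] in every dimension; [Q ^ d] would already control the growth
   of [c]. *)
pose G : R := (Q ^ d.+1)%:R.
have b_gt0 k : (0 < b k)%N.
  by elim: k => // k IH; rewrite bQ muln_gt0 IH expn_gt0 ltnW.
have c_ge0 k : 0 <= c k by [].
have G2 : 2 <= G.
  by rewrite /G ler_nat expnS (leq_trans Q1)// leq_pmulr// expn_gt0 ltnW.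
have cS k : c k.+1 <= G ^+ k.+2 * c k.
  rewrite /c /G -natrX -natrM ler_nat bQ mulnCA expnMn leq_mul//.
  by rewrite -!expnM leq_exp2l// mulnC mulSn leq_addl.
have cball k m : (m <= b k.+1)%N -> ((m.*2.+1 ^ d)%:R : R) <= c k.
  move=> mb; rewrite ler_nat; case: (d) => // d'; rewrite leq_exp2r//.
  by have := b_gt0 k.+1; lia.
have nS k : ((n k.+1)%:R : R) <= c k * (n k)%:R ^+ 2.
  rewrite /n /= natrM -natrX ler_wpM2r//; apply: cball.
  by have := bS k; lia.
(* This is the equality case of [bound] at [k = 0], where [n 0 = 1]. *)
pose q0 : R := (c 0%N * G ^+ 4)^-1.
have G0 : 0 < G by exact: lt_le_trans G2.
have c0 : 0 < c 0%N by rewrite ltr0n expn_gt0 muln_gt0 b_gt0.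
have q00 : 0 < q0 by rewrite invr_gt0 mulr_gt0// exprn_gt0.
apply: (subcritical_criterion q00) => q t q01 qq0.
have [q_ge0 _] := andP q01.
(* Writing t_k = c_k n_k q^(2^k), cS and nS give t_(k+1) <= G^(k+2) t_k^2. *)
have bound k : c k * (n k)%:R * q ^+ (2 ^ k) * G ^+ (k + 4) <= 1.
  elim: k => [|k IH].
    have -> : c 0%N * (n 0%N)%:R * q ^+ (2 ^ 0) * G ^+ (0 + 4) =
        q * (c 0%N * G ^+ 4) by rewrite /n /=; ring.
    rewrite -ler_pdivlMr; last by rewrite mulr_gt0// exprn_gt0.
    by rewrite div1r.
  set T := _ * _ in IH.
  have T0 : 0 <= T by rewrite !mulr_ge0// exprn_ge0// ltW.
  have : T ^+ 2 <= 1 by rewrite expr_le1.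
  apply: le_trans.
  have -> : T ^+ 2 = G ^+ k.+2 * c k * (c k * (n k)%:R ^+ 2) *
      q ^+ (2 ^ k.+1) * G ^+ (k.+1 + 4) * G.
    rewrite /T expnS mulnC exprM !addSn !addnS !addn0 !exprS !expr0.
    by ring.
  rewrite -[leLHS]mulr1; apply: ler_pM => //; last by lra.
    by rewrite !mulr_ge0// exprn_ge0// ltW.
  rewrite ler_wpM2r ?exprn_ge0 ?(ltW G0)// ler_wpM2r ?exprn_ge0//.
  exact: ler_pM.
pose F k := flatten [seq trees H k y | y <- ball_seq (d := d) (rho k)].
have sumF k : \sum_(V <- F k) q ^+ #|` V| <= (2 ^+ k.+2)^-1.
  apply: (@le_trans _ _ (c k * (n k)%:R * q ^+ (2 ^ k))).
    rewrite big_flatten big_map /=.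
    apply: (@le_trans _ _
        (\sum_(y <- ball_seq (d := d) (rho k)) (n k)%:R * q ^+ (2 ^ k))).
      apply: ler_sum => y _; rewrite (eq_big_seq (fun=> q ^+ (2 ^ k))).
        rewrite big_const_seq count_predT iter_addr_0 -[leLHS]mulr_natl.
        by rewrite ler_wpM2r ?exprn_ge0// ler_nat size_trees.
      by move=> V /card_trees ->.
    rewrite big_const_seq count_predT iter_addr_0 -[leLHS]mulr_natl -mulrA.
    rewrite ler_wpM2r ?mulr_ge0 ?exprn_ge0// size_ball_seq.
    exact: cball.
  rewrite -div1r ler_pdivlMr ?exprn_gt0//; apply: le_trans (bound k).
  rewrite ler_wpM2l ?mulr_ge0 ?exprn_ge0//.
  apply: (@le_trans _ _ (2 ^+ (k + 4))).
    by rewrite ler_eXn2l ?ltr1n//; lia.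
  by rewrite lerXn2r// ?nnegrE// ltW.
(* By time [t] only the sites within [r0 * t] can influence the origin, so finitely many levels
   matter and the union is finite. *)
pose M := (r0 * t)%N.
have [N NE] : exists N, N = M.*2.+1 by exists M.*2.+1.
pose FM := flatten [seq F k | k <- iota 0 N].
apply: (@le_trans _ _ (\sum_(V <- FM) q ^+ #|` V|)%:E).
  apply: bernoulli_product_union_bound => //; first exact: measurable_bp.
  move=> w /= wt.
  pose A y := is_true (w y && (l1 y <= M)%N).
  have AM a : A a -> (l1 a <= M)%N by move=> /andP[].
  have [|k [a [kM la xa]]] := near A (fun y => w y && (l1 y <= M)%N) M AM
    (fun a => id) t 0.
    by apply: bp_finite_speed Xr _ _ _ _ wt; rewrite l1_0.
  have [V [VT VA _]] := level_trees b0 bS bH la.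
  exists V; last by apply/allP => y /VA/andP[].
  apply/flattenP; exists (F k); first by rewrite map_f// mem_iota NE.
  apply/flattenP; exists (trees H k a) => //; rewrite map_f//.
  by apply: mem_ball_seq; rewrite -l1N -sub0r.
rewrite lee_fin /FM big_flatten big_map.
apply: (@le_trans _ _ (2^-1 - (2 ^+ N.+1)^-1)); last first.
  by rewrite gerBl invr_ge0 exprn_ge0.
elim: {NE FM} N => [|m IH]; first by rewrite /= big_nil expr1 subrr.
rewrite -addn1 iotaD big_cat big_seq1 add0n addn1.
apply: le_trans (lerD IH (sumF m)) _.
rewrite [2 ^+ m.+2]exprS invfM; lra.
Qed.

End eroder.

(** * Growing tubes *)

Section bp_monotone.
Context {d : nat} (X : {fset {fset 'rV[int]_d}}).

Lemma bp_shift (w1 w2 : config 'rV[int]_d) y :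
  (forall x, w1 x -> w2 (x - y)) ->
  forall t x, bp X w1 t x -> bp X w2 t (x - y).
Proof.
move=> w12; elim=> [|t IH] x; first exact: w12.
rewrite /bp !iterS -!/(bp X _ t) /bp_step => /orP[/IH->//|].
move=> /hasP[U UX /allP wU]; apply/orP; right; apply/hasP; exists U => //.
by apply/allP => z zU; rewrite addrAC; apply: IH; exact: wU.
Qed.

Lemma bp_time (w : config 'rV[int]_d) t t' x :
  (t <= t')%N -> bp X w t x -> bp X w t' x.
Proof.
move=> /subnKC <-; elim: (t' - t)%N => [|n IH]; first by rewrite addn0.
by move=> /IH; rewrite addnS /bp iterS -/(bp X w (t + n)) /bp_step => ->.
Qed.

End bp_monotone.

Section inner_morphisms.
Context {R : realType} {d : nat}.
Implicit Types (x y : 'rV[int]_d) (u v : 'rV[R]_d).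

Lemma inner0 u : inner (0 : 'rV[int]_d) u = 0.
Proof. by apply: big1 => i _; rewrite mxE mul0r. Qed.

Lemma innerN x u : inner (- x) u = - inner x u.
Proof. by apply/eqP; rewrite -addr_eq0 -innerD addNr inner0. Qed.

Lemma innerMn x n u : inner (x *+ n) u = n%:R * inner x u.
Proof.
elim: n => [|n IH]; first by rewrite mulr0n inner0 mul0r.
by rewrite mulrS innerD IH mulrS mulrDl mul1r.
Qed.

Lemma inner_sum (T : finType) (F : T -> 'rV[int]_d) u :
  inner (\sum_i F i) u = \sum_i inner (F i) u.
Proof.
apply: (big_morph (fun x => inner x u)); last exact: inner0.
by move=> x y; exact: innerD.
Qed.

Lemma inner_delta x j : inner x (delta_mx 0 j : 'rV[R]_d) = (x 0 j)%:~R.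
Proof.
rewrite /inner (bigD1 j)//= mxE !eqxx mulr1 big1 ?addr0// => i ij.
by rewrite mxE (negbTE ij) mulr0.
Qed.

End inner_morphisms.

(** The inverse of 1 plus the sum of the inverses also serves when [T] is empty. *)
Lemma finite_pos_lower_bound (R : realType) (T : finType) (F : T -> R) :
  (forall z, 0 < F z) -> exists2 c, 0 < c & forall z, c <= F z.
Proof.
move=> F0; pose Y := \sum_z (F z)^-1.
have Y0 : 0 <= Y by apply: sumr_ge0 => z _; rewrite invr_ge0 ltW.
exists (1 + Y)^-1; first by rewrite invr_gt0 ltr_wpDr.
move=> z; rewrite -[F z]invrK lef_pV2 ?posrE ?invr_gt0 ?ltr_wpDr//.
rewrite /Y (bigD1 z)//= addrCA lerDl addr_ge0// sumr_ge0// => i _.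
by rewrite invr_ge0 ltW.
Qed.

(** Dependent finite functions form a [finType], which can index the functionals of [gordan] and the
    forms [L i]. *)
Definition selection (d : nat) (X : {fset {fset 'rV[int]_d}}) : finType :=
  {dffun forall U : X, fset_sub_type (val U)}.

Section tube.
Context {R : realType} {d : nat} (X : {fset {fset 'rV[int]_d}}).
Variables (u : 'rV[R]_d) (v : 'rV[R]_d -> R).

Let Z : {fset 'rV[int]_d} := (\bigcup_(U <- X) U)%fset.

Let memZ U z : U \in X -> z \in U -> z \in Z.
Proof. by move=> UX zU; apply/bigfcupP; exists U; rewrite ?UX. Qed.

Hypothesis u0 : forall U z, U \in X -> z \in U -> inner z u < 0.
Hypothesis vu : v u < 0.
Hypothesis vcone : forall f : selection X, exists mu : Z -> R,
  [/\ forall z, 0 <= mu z,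
      forall z, 0 < mu z -> exists U, val (f U) = val z &
      forall e, v e = \sum_z mu z * inner (val z) e].
Variable f0 : selection X.

Let uZ (z : Z) : inner (val z) u < 0.
Proof.
by have /bigfcupP[U /andP[UX _] zU] := valP z; exact: u0 zU.
Qed.

Let cone_pos (mu : Z -> R) : (forall z, 0 <= mu z) ->
  (forall e, v e = \sum_z mu z * inner (val z) e) -> exists z, 0 < mu z.
Proof.
move=> mu0 vE; apply: contrapT => n0; move: vu; rewrite vE big1 ?ltxx// => z _.
have -> : mu z = 0; last by rewrite mul0r.
apply/eqP; rewrite eq_le mu0 andbT leNgt; apply/negP => mz.
by apply: n0; exists z.
Qed.

(* The vector v is represented by the linear form e |-> <v, e>. *)
Definition tube (x : 'rV[int]_d) := exists (a : Z -> R) (t : R),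
  [/\ 0 <= t, forall z, 0 <= a z <= 1 &
      forall e, inner x e = \sum_z a z * inner (val z) e - t * v e].

(* Otherwise a selection f of points with x + f U outside the tube exists;
   sliding x = sum a_z z - t v along v = sum mu_z z, mu supported by f, until
   some coefficient a_(f U) vanishes leaves room for adding f U. *)
Lemma tube_step x : tube x -> 0 < inner x u ->
  exists2 U, U \in X & forall z, z \in U -> tube (x + z).
Proof.
move=> [a [t [t0 a01 xE]]] xu; apply: contrapT => nU.
have sel (U : X) : exists z : fset_sub_type (val U), ~ tube (x + val z).
  apply: contrapT => nz; apply: nU; exists (val U); first exact: valP.
  move=> z zU; apply: contrapT => nt; apply: nz.
  by exists [` zU]%fset.
pose f : selection X := [ffun U => projT1 (cid (sel U))].
have fP U : ~ tube (x + val (f U)).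
  by rewrite ffunE; exact: projT2 (cid (sel U)).
have [mu [mu0 muf vE]] := vcone f.
have slide s e : inner x e =
    \sum_z (a z - s * mu z) * inner (val z) e - (t - s) * v e.
  rewrite xE [in RHS](eq_bigr (fun z => a z * inner (val z) e -
      s * (mu z * inner (val z) e))); last by move=> z _; ring.
  by rewrite sumrB -mulr_sumr -vE; ring.
have [z0 muz0] := cone_pos mu0 vE.
pose z1 := [arg min_(z < z0 | 0 < mu z) (a z / mu z)]%O.
have [muz1 z1min] : 0 < mu z1 /\
    forall z, 0 < mu z -> a z1 / mu z1 <= a z / mu z.
  by rewrite /z1; case: arg_minP.
pose s := a z1 / mu z1.
have s0 : 0 <= s by rewrite divr_ge0//; case/andP: (a01 z1).
have slide_ge0 s' z : s' <= s -> 0 <= a z - s' * mu z.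
  move=> s's; have [az0 _] := andP (a01 z).
  have [mz|] := ltP 0 (mu z); last first.
    move=> mz; have -> : mu z = 0 by apply/eqP; rewrite eq_le mz mu0.
    by rewrite mulr0 subr0.
  rewrite subr_ge0 -ler_pdivlMr//; apply: le_trans s's _; exact: z1min.
have slide_le1 s' z : 0 <= s' -> a z - s' * mu z <= 1.
  move=> s'0; have [_ az1] := andP (a01 z).
  by have := mulr_ge0 s'0 (mu0 z); lra.
(* If the axial parameter [t] runs out first, [x] is a nonnegative combination of points of the
   rules, so [inner x u <= 0], a contradiction. *)
have [st|ts] := leP s t; last first.
  move: xu; rewrite (slide t) subrr mul0r subr0 ltNge => /negP; apply.
  apply: sumr_le0 => z _; apply: mulr_ge0_le0; last exact: ltW.
  by apply: slide_ge0; exact: ltW.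
have [U fU] := muf z1 muz1; apply: (fP U); rewrite fU.
exists (fun z => a z - s * mu z + (z == z1)%:R), (t - s); split.
- by rewrite subr_ge0.
- move=> z; case: eqP => [->|_]; last first.
    by rewrite addr0 slide_ge0// slide_le1.
  by rewrite /s divfK ?gt_eqF// subrr add0r ler01 lexx.
- move=> e; rewrite innerD (slide s).
  rewrite [in RHS](eq_bigr (fun z => (a z - s * mu z) * inner (val z) e +
    (z == z1)%:R * inner (val z) e)); last by move=> z _; rewrite mulrDl.
  rewrite big_split /= [X in _ = _ + X - _](bigD1 z1)//= eqxx mul1r.
  rewrite [X in _ = _ + (_ + X) - _]big1 ?addr0; last first.
    by move=> z /negbTE ->; rewrite mul0r.
  by rewrite addrAC.
Qed.

(** The contribution [- t * v u] to [inner x u] is nonnegative and the rest is bounded, so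
    [inner x u <= 0] bounds [t] and then every coordinate. *)
Lemma tube_base_bounded : exists N, forall x, tube x -> inner x u <= 0 ->
  (l1 x <= N)%N.
Proof.
pose B (e : 'rV[R]_d) : R := \sum_(z : Z) `|inner (val z) e|.
pose T := B u / - v u.
have T0 : 0 <= T by rewrite divr_ge0 ?oppr_ge0 ?(ltW vu)// sumr_ge0.
pose C := \sum_j (B (delta_mx 0 j) + T * `|v (delta_mx 0 j)|).
exists (Num.bound C) => x [a [t [t0 a01 xE]]] xu.
have aB e : `|\sum_z a z * inner (val z) e| <= B e.
  apply: le_trans (ler_norm_sum _ _ _) _; apply: ler_sum => z _.
  have [? ?] := andP (a01 z).
  by rewrite normrM ger0_norm// ler_piMl.
have tT : t <= T.
  rewrite ler_pdivlMr ?oppr_gt0//; have := aB u; rewrite ler_norml.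
  move=> /andP[+ _]; move: xu; rewrite xE; lra.
have B0 e : 0 <= B e by rewrite sumr_ge0.
rewrite -(ler_nat R); apply: le_trans (ltW (archi_boundP _)); last first.
  by apply: sumr_ge0 => j _; rewrite addr_ge0// mulr_ge0.
rewrite /l1 natr_sum; apply: ler_sum => j _.
rewrite natr_absz intr_norm -inner_delta xE.
apply: le_trans (ler_normB _ _) _; apply: lerD => //.
by rewrite normrM ger0_norm// ler_wpM2r.
Qed.

(** Rounding [n mu] down gives a lattice point on the ray of [- v] up to fractional parts, which
    serve as the coefficients [a]; its product with [u] grows linearly in [n]. *)
Lemma tube_unbounded (c : R) : exists2 y, tube y & c < inner y u.
Proof.
have [mu [mu0 _ vE]] := vcone f0.
have [z0 muz0] := cone_pos mu0 vE.
pose g := - (mu z0 * inner (val z0) u).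
have g0 : 0 < g by rewrite oppr_gt0 pmulr_rlt0.
pose h := - inner (val z0) u.
have h0 : 0 < h by rewrite oppr_gt0.
pose n := Num.bound ((`|c| + h) / g).
have ng : `|c| + h < n%:R * g.
  by rewrite -ltr_pdivrMr// archi_boundP// divr_ge0 ?addr_ge0 ?(ltW g0)// ltW.
pose m z := Num.trunc (n%:R * mu z).
have mP z : (m z)%:R <= n%:R * mu z < (m z)%:R + 1.
  by have := truncn_itv (mulr_ge0 (ler0n R n) (mu0 z)); rewrite -natr1.
have yE e : inner (- \sum_z val z *+ m z) e =
    - \sum_z (m z)%:R * inner (val z) e.
  rewrite innerN inner_sum; congr (- _).
  by apply: eq_bigr => z _; exact: innerMn.
exists (- \sum_z val z *+ m z).
  exists (fun z => n%:R * mu z - (m z)%:R), n%:R; split=> //.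
    by move=> z; have /andP[? ?] := mP z; apply/andP; split; lra.
  move=> e; rewrite yE vE mulr_sumr -sumrB -sumrN; apply: eq_bigr => z _; ring.
rewrite yE -sumrN (bigD1 z0)//=.
have : 0 <= \sum_(i | i != z0) - ((m i)%:R * inner (val i) u).
  by apply: sumr_ge0 => z _; rewrite oppr_ge0 mulr_ge0_le0// ltW.
have /andP[_ mz0] := mP z0.
have : (n%:R * mu z0 - 1) * h <= (m z0)%:R * h.
  by rewrite ler_wpM2r ?(ltW h0)// lerBlDr ltW.
have := ler_norm c.
by move: ng; rewrite /g /h; lra.
Qed.

(** [tube_step] reduces [x] to tube points whose product with [u] is smaller by at least a fixed
    [c]; after finitely many steps the bounded base of the tube is reached. *)
Lemma tube_infected : exists A : {fset 'rV[int]_d}, forall x, tube x ->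
  exists k, bp X (fun y => y \in A) k x.
Proof.
have [N xN] := tube_base_bounded.
have [|c c0 cZ] := @finite_pos_lower_bound R Z (fun z => - inner (val z) u).
  by move=> z; rewrite oppr_gt0.
exists [fset x in ball_seq N]%fset.
have inA x : (l1 x <= N)%N -> x \in [fset x in ball_seq (d := d) N]%fset.
  by move=> /mem_ball_seq; rewrite inE.
suff H k x : tube x -> inner x u <= k%:R * c ->
    bp X (fun y => y \in [fset x in ball_seq (d := d) N]%fset) k x.
  move=> x Tx; exists (Num.bound (`|inner x u| / c)); apply: H => //.
  rewrite -ler_pdivrMr//; apply: le_trans (ltW (archi_boundP _)); last first.
    by rewrite divr_ge0// ltW.
  by rewrite ler_wpM2r ?invr_ge0 ?(ltW c0)// ler_norm.
elim: k x => [|k IH] x Tx xk.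
  by apply: inA; apply: xN => //; rewrite mul0r in xk.
have [x0|x0] := leP (inner x u) 0.
  apply: (bp_time (leq0n k.+1)).
  exact/inA/xN.
have [U UX TU] := tube_step Tx x0.
rewrite /bp iterS -/(bp X _ k) /bp_step; apply/orP; right.
apply/hasP; exists U => //; apply/allP => z zU; apply: IH; first exact: TU.
have := cZ [` memZ UX zU]%fset; rewrite /= innerD.
by move: xk; rewrite -natr1; lra.
Qed.

Lemma tube_supercritical : supercritical X.
Proof.
have [A AT] := tube_infected; exists A => /finite_fsetP[F FE].
have [y Ty yF] := tube_unbounded (\sum_(x <- F) `|inner x u|).
have [k yk] := AT y Ty.
have : y \in F.
  suff : [set` F] y by [].
  (* Time [k.+1] instead of [k], because [supercritical] counts positive times only. *)
  by rewrite -FE; exists k.+1 => //=; exact: bp_time (leqnSn k) yk.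
move=> yinF; move: yF; rewrite (big_rem y)//= ltNge => /negP; apply.
by rewrite (le_trans (ler_norm _))// lerDl sumr_ge0.
Qed.

(** The blocks are translates [A - y] with [y] in the tube: [A] infects [y], hence [A - y] infects
    the origin. *)
Lemma tube_not_subcritical : ~ subcritical R X.
Proof.
have [A AT] := tube_infected.
apply: (@not_subcritical_criterion R d X #|` A|) => N.
suff : forall S : {fset 'rV[int]_d}, exists t0 (Bs : seq {fset 'rV[int]_d}),
    [/\ fdisjoints S Bs, size Bs = N, forall B, B \in Bs -> #|` B| = #|` A| &
     forall B w t, B \in Bs -> (t0 <= t)%N -> all w B -> bp X w t 0] by exact.
elim: N => [|N IH] V; first by exists 0%N, [::].
(* A common point of [A - y] and [V] would write [y] as a difference of points of [A] and [V], which
   this lower bound on [inner y u] excludes. *)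
have [y Ty yV] := tube_unbounded
  (\sum_(x <- A) `|inner x u| + \sum_(x <- V) `|inner x u|).
have [k yk] := AT y Ty.
pose B := [fset a - y | a in A]%fset.
have [t0 [Bs [dBs sBs nBs iBs]]] := IH (V `|` B)%fset.
exists (maxn k t0), (B :: Bs); split.
- rewrite /= dBs andbT; apply/fdisjointP => x xV; apply/negP.
  move=> /imfsetP[a /= aA xE]; move: yV.
  have -> : y = a - x by rewrite xE opprB addrC subrK.
  rewrite innerD innerN ltNge => /negP; apply.
  rewrite (big_rem a)//= [X in _ <= _ + X](big_rem x)//=.
  have : 0 <= \sum_(x <- rem a A) `|inner x u| by rewrite sumr_ge0.
  have : 0 <= \sum_(x <- rem x V) `|inner x u| by rewrite sumr_ge0.
  have := ler_norm (inner a u); have := ler_norm (- inner x u).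
  by rewrite normrN; lra.
- by rewrite /= sBs.
- move=> B'; rewrite inE => /orP[/eqP ->|]; last exact: nBs.
  by rewrite card_imfset//=; exact: addIr.
- move=> B' w t; rewrite inE => /orP[/eqP ->|B'Bs]; last first.
    by rewrite geq_max => /andP[_]; exact: iBs.
  rewrite geq_max => /andP[kt _] /allP wB.
  apply: (bp_time kt); rewrite -(subrr y).
  by apply: (bp_shift _ yk) => x xA; apply: wB; exact: in_imfset.
Qed.

End tube.

Lemma innerP (R : realType) (d : nat) (x : 'rV[int]_d) :
  linear (inner x : 'rV[R]_d -> R^o).
Proof.
move=> c y z; rewrite /inner /GRing.scale /= mulr_sumr -big_split /=.
by apply: eq_bigr => i _; rewrite !mxE; ring.
Qed.

(** * Families containing the empty rule *)

Section empty_update.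
Context {R : realType} {d : nat} (X : {fset {fset 'rV[int]_d}}).
Hypothesis X0 : fset0 \in X.

Let bp1 w t x : (0 < t)%N -> bp X w t x.
Proof.
case: t => // t _; rewrite /bp iterS /bp_step; apply/orP; right.
by apply/hasP; exists fset0.
Qed.

Lemma empty_update_supercritical : (0 < d)%N -> supercritical X.
Proof.
move=> d0; exists fset0 => /finite_fsetP[F FE].
pose m := (\sum_(x <- F) l1 x)%N.
pose y : 'rV[int]_d := const_mx m.+1%:Z.
have : y \in F.
  suff : [set` F] y by [].
  by rewrite -FE; exists 1%N => //; exact: bp1.
move=> yF; have : (l1 y <= m)%N by rewrite /m (big_rem y)//= leq_addr.
by rewrite /l1 (bigD1 (Ordinal d0))//= mxE; lia.
Qed.

(** Empty blocks are disjoint and always full, and every site is infected at time 1. *)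
Lemma empty_update_not_subcritical : ~ subcritical R X.
Proof.
apply: (@not_subcritical_criterion R d X 0) => N; exists 1%N, (nseq N fset0).
split.
- elim: N (X in fdisjoints X _) => //= N IH V.
  by rewrite fdisjointX0 IH.
- exact: size_nseq.
- by move=> B /nseqP[-> _]; rewrite cardfs0.
- by move=> B w t _ t1 _; exact: bp1.
Qed.

End empty_update.

Theorem theorem1p10 (R : realType) (d : nat) (hd : (1 <= d)%N)
    (X : {fset {fset 'rV[int]_d}}) (hX : is_update_family X)
    (hu : in_half_space R X) :
  (supercritical X /\ ~ subcritical R X) \/
  (~ supercritical X /\ subcritical R X).
Proof.
(* An empty rule admits no selection, so this case is treated apart. *)
have [X0|nX0] := pselect (fset0 \in X).
  by left; split;
    [exact: empty_update_supercritical|exact: empty_update_not_subcritical].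
have [u uX] := hu.
have [f0 _] : exists f0 : selection X, true.
  have ne (U : X) : exists z, z \in val U.
    apply/fset0Pn; apply: contra_notN nX0 => /eqP <-; exact: valP.
  exists [ffun U : X => [` projT2 (cid (ne U))]%fset : fset_sub_type (val U)].
  by [].
(* Gordan's alternative is applied to families of vectors indexed by selections and summing to 0,
   with one functional for each pair of a selection and a rule. *)
pose W : lmodType R := {ffun selection X -> 'rV[R]_d}.
pose K : finType := (selection X * X)%type.
have [a aE] : exists a : K -> {linear W -> R^o},
    forall k w, a k w = inner (val (k.1 k.2)) (w k.1).
  have mk (k : K) : exists g : {linear W -> R^o},
      forall w, g w = inner (val (k.1 k.2)) (w k.1).
    have lin : linear (fun w : W => inner (val (k.1 k.2)) (w k.1) : R^o).
      by move=> c y z; rewrite !ffunE innerP.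
    pose hg := GRing.isLinear.Build _ _ _ _ _ lin.
    pose g : {linear W -> R^o} :=
      HB.pack (fun w : W => inner (val (k.1 k.2)) (w k.1) : R^o) hg.
    by exists g.
  by have [g gE] := choice mk; exists g.
have [||[w [w0 [s s0 sw]]]|[l [l0 [[f1 U1] l1] lE]]] :=
    gordan (Z := fun w : W => \sum_f w f = 0) a.
- by apply: big1 => f _; rewrite ffunE.
- move=> c x y x0 y0; under eq_bigr do rewrite !ffunE.
  by rewrite big_split /= -scaler_sumr x0 y0 scaler0 addr0.
- right; have us U (f : selection X) :
      U \in X -> exists2 z, z \in U & s <= inner z (w f).
    move=> UX; exists (val (f [` UX]%fset)); first exact: valP (f [` UX]%fset).
    by have := sw (f, [` UX]%fset); rewrite aE.
  split; first exact: (@eroder_not_supercritical R d X _ f0 w s w0 s0 us).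
  exact: (@eroder_subcritical R d X _ f0 w s w0 s0 us).
pose v (f : selection X) (e : 'rV[R]_d) :=
  \sum_U l (f, U) * inner (val (f U)) e.
have vE f g e : v f e = v g e.
  have [->//|fg] := eqVneq f g.
  (* Testing the dual relation on the family with [e] at [f] and [- e] at [g] shows that all
     selections give the same cone vector. *)
  pose w : W := [ffun h => (h == f)%:R *: e - (h == g)%:R *: e].
  have w0 : \sum_h w h = 0.
    under eq_bigr do rewrite ffunE.
    rewrite sumrB -!scaler_suml.
    rewrite (bigD1 f)//= eqxx big1 => [|i /negbTE ->//].
    rewrite (bigD1 g)//= eqxx big1 => [|i /negbTE ->//].
    by rewrite subrr.
  have := lE w w0.
  rewrite (eq_bigr (fun k => l (k.1, k.2) * a (k.1, k.2) w)); last by case.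
  rewrite -(pair_bigA _ (fun h U => l (h, U) * a (h, U) w)) /=.
  rewrite (eq_bigr (fun h => v h (w h))); last first.
    by move=> h _; apply: eq_bigr => U _; rewrite aE.
  have v0 h : v h 0 = 0.
    apply: big1 => U _; rewrite /inner big1 ?mulr0// => i _.
    by rewrite mxE mulr0.
  have vN h : v h (- e) = - v h e.
    rewrite /v -sumrN; apply: eq_bigr => U _; rewrite -mulrN; congr (_ * _).
    by rewrite /inner -sumrN; apply: eq_bigr => i _; rewrite mxE mulrN.
  rewrite (bigD1 f)//= (bigD1 g) 1?eq_sym//=.
  rewrite big1 => [|h /andP[hf hg]]; last first.
    by rewrite /w ffunE (negbTE hf) (negbTE hg) !scale0r subrr v0.
  rewrite /w !ffunE !eqxx (negbTE fg) eq_sym (negbTE fg) !scale0r !scale1r.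
  by rewrite subr0 sub0r vN addr0 => /subr0_eq.
(* The half-space condition makes all terms nonpositive, and the positive multiplier at [(f1, U1)]
   makes one negative. *)
have vu : v f1 u < 0.
  rewrite /v (bigD1 U1)//= -[ltRHS]addr0 ltr_leD//.
    by rewrite pmulr_rlt0//; exact: uX (valP U1) (valP (f1 U1)).
  apply: sumr_le0 => U _; rewrite mulr_ge0_le0// ltW//.
  exact: uX (valP U) (valP (f1 U)).
pose Z := (\bigcup_(U <- X) U)%fset.
have vcone (f : selection X) : exists mu : Z -> R,
  [/\ forall z, 0 <= mu z,
      forall z, 0 < mu z -> exists U, val (f U) = val z &
      forall e, v f1 e = \sum_z mu z * inner (val z) e].
  have fZ (U : X) : val (f U) \in Z.
    by apply/bigfcupP; exists (val U); [rewrite andbT; exact: valP|exact: valP].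
  (* Several rules may select the same point, so their multipliers are added up. *)
  exists (fun z => \sum_(U | [` fZ U]%fset == z) l (f, U)); split.
  - by move=> z; apply: sumr_ge0.
  - move=> z lz; apply: contrapT => nz; move: lz; rewrite big1 ?ltxx// => U.
    by move=> /eqP fU; case: nz; exists U; rewrite -fU.
  - move=> e; rewrite (vE f1 f) /v.
    rewrite (partition_big (fun U => [` fZ U]%fset) xpredT)//=.
    apply: eq_bigr => z _; rewrite mulr_suml; apply: eq_bigr => U /eqP <-.
    by [].
left; split; first exact: (@tube_supercritical R d X u (v f1) uX vu vcone f0).
exact: (@tube_not_subcritical R d X u (v f1) uX vu vcone f0).
Qed.
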